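(* Let $\sigma,p>0$. Given any measure $\mu_0\in\mathcal{P}_0(\Omega)$ with $\operatorname{supp}\mu_0\subset R_0=[y_{\min},y_{\max}]\times[\theta_{\min},\theta_{\max}]$, $y_{\min},\theta_{\min}>0$, there exists a unique (global in time) measure-valued solution $(\mu_t)_{t\ge0}$ to $$\partial_t\mu+\partial_y(u(\mu)\mu)=0$$ with initial condition $\mu_0$ and such that $\operatorname{supp}\mu_t\subset\Omega$ remains bounded and bounded away from $\partial\Omega$ uniformly for all times $t\ge0$.
   Context: $\mathbb{R}_+=(0,\infty)$, $\Omega=\mathbb{R}_+\times\mathbb{R}_+$ with points $(y,\theta)$. $\mathcal{P}_0(\Omega)$ is the set of Borel probability measures on $\Omega$ with compact support contained in $\Omega$. The velocity is $$u(\mu_t)(y,\theta)=\int_\Omega (z-y)\,d\mu_t(z,\eta)+\sigma(\theta-y^p)y .$$ A measure-valued solution on $[0,T)$ with initial data $\mu_0$ is a weakly* continuous map $t\mapsto\mu_t\in\mathcal{P}_0(\Omega)$, $t\in[0,T)$, such that for all $\varphi\in C_0^\infty([0,T)\times\Omega)$ and $0<t<T$, $$\int_\Omega\varphi(t,y,\theta)\,d\mu_t(y,\theta)=\int_\Omega\varphi(0,y,\theta)\,d\mu_0(y,\theta)+\int_0^t\int_\Omega[\partial_s\varphi+u(\mu_s)\,\partial_y\varphi]\,d\mu_s(y,\theta)\,ds .$$ A global solution is a map on $[0,\infty)$ whose restriction to $[0,T)$ is a measure-valued solution for every $T>0$. *)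

(* Defs.v *)
From HB Require Import structures.
From mathcomp Require Import all_boot all_order all_algebra.
From mathcomp Require Import all_classical all_reals all_analysis.

Set Implicit Arguments.
Unset Strict Implicit.
Unset Printing Implicit Defensive.
Import Order.TTheory GRing.Theory Num.Theory.
Import numFieldNormedType.Exports.

Local Open Scope classical_set_scope.
Local Open Scope ring_scope.

Section Defs.
Context {R : realType}.

Definition Omega : set (R * R) := [set x | 0 < x.1 /\ 0 < x.2].

Definition frontier {T : topologicalType} (A : set T) : set T :=
  closure A `\` interior A.

(* A Borel probability measure on Omega with compact support is identified with
   its extension by zero to the plane; the product sigma-algebra of the plane
   is its Borel sigma-algebra. *)
Definition planar_probability :=
  probability (measurableTypeR R * measurableTypeR R)%type R.

Definition supp (mu : planar_probability) : set (R * R) :=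
  [set x | forall U : set (R * R), open U -> U x -> (0 < mu U)%E].

Definition in_P0 (mu : planar_probability) : Prop :=
  compact (supp mu) /\ supp mu `<=` Omega.

(* Leibniz equality would also compare the values on non-measurable sets, where
   a MathComp-Analysis measure is unconstrained. *)
Definition same_measure (mu nu : planar_probability) : Prop :=
  forall A, measurable A -> mu A = nu A.

(* C_0(Omega), the predual of the finite signed measures on Omega: continuous
   functions vanishing at infinity, extended by zero to the plane. *)
Definition C0_Omega (f : R * R -> R) : Prop :=
  continuous f /\
  forall e : R, 0 < e ->
    compact [set x | e <= `|f x|] /\ [set x | e <= `|f x|] `<=` Omega.

Definition weak_star_continuous (I : set R) (mu : R -> planar_probability) :=
  forall f, C0_Omega f ->
    {within I, continuous (fun t => \int[mu t]_(x in Omega) f x)}.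

Fixpoint Ck {V : normedModType R} (k : nat) (f : V -> R) : Prop :=
  if k is k'.+1 then
    continuous f /\
    forall v : V, (forall x, derivable f x v) /\ Ck k' ('D_v f)
  else continuous f.

Definition smooth {V : normedModType R} (f : V -> R) : Prop :=
  forall k, Ck k f.

(* C_0^oo([0, T) x Omega): restrictions to nonnegative times of smooth functions
   on space-time with compact support in (-oo, T) x Omega, so that a test
   function is smooth up to t = 0 and need not vanish there.
   Points are written (t, (y, theta)). *)
Definition test_function (T : R) (phi : R * (R * R) -> R) : Prop :=
  let K := closure [set z | phi z != 0] in
  [/\ smooth phi, compact K & forall z : R * (R * R), K z -> z.1 < T /\ Omega z.2].

Definition dt (phi : R * (R * R) -> R) : R * (R * R) -> R :=
  'D_(1, (0, 0)) phi.

Definition dy (phi : R * (R * R) -> R) : R * (R * R) -> R :=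
  'D_(0, (1, 0)) phi.

Definition velocity (sigma p : R) (mu : planar_probability) (x : R * R) : R :=
  \int[mu]_(z in Omega) (z.1 - x.1) + sigma * (x.2 - x.1 `^ p) * x.1.

(* The weak formulation is an identity of extended reals with finite left-hand
   side, so it also forces the time integral to be finite. *)
Definition measure_valued_solution (sigma p T : R) (mu0 : planar_probability)
    (mu : R -> planar_probability) : Prop :=
  [/\ forall t : R, 0 <= t < T -> in_P0 (mu t),
      weak_star_continuous `[0, T[ mu,
      same_measure (mu 0) mu0 &
      forall phi, test_function T phi -> forall t : R, 0 < t < T ->
        (\int[mu t]_(x in Omega) (phi (t, x))%:E =
         \int[mu0]_(x in Omega) (phi (0, x))%:E +
         \int[@lebesgue_measure R]_(s in `[0%R, t])
           \int[mu s]_(x in Omega)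
             (dt phi (s, x) + velocity sigma p (mu s) x * dy phi (s, x))%:E)%E].

Definition global_solution (sigma p : R) (mu0 : planar_probability)
    (mu : R -> planar_probability) : Prop :=
  forall T, 0 < T -> measure_valued_solution sigma p T mu0 mu.

Definition uniformly_inside_Omega (mu : R -> planar_probability) : Prop :=
  let S := \bigcup_(t in [set t : R | 0 <= t]) supp (mu t) in
  [/\ S `<=` Omega, bounded_set S &
    exists2 r : R, 0 < r &
      forall x z : R * R, S x -> frontier Omega z -> r <= `|x - z|].

End Defs.

(* Main.v *)
(* The label theta is constant along the flow, so mu_t is carried by the characteristics
   y' = m(t) + drift(y, theta), where m is the mean of the first coordinate.  If
   a^p <= theta <= b^p on the support, the velocity points inwards at y = a and at y = b,
   so the box [a, b] x [c, d] is invariant and y^p may be replaced there by a globally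
   smooth g.

   Existence: explicit Euler steps map measurable functions with values in [a, b] to such
   functions; the dyadic Euler iterations converge uniformly to a flow Y which has a
   second-order Taylor expansion in time, and mu_t is the image of mu0 under it.

   Uniqueness: for a solution and a test function psi, the weak form gives
   mu_{t+h}(psi) = mu_t(psi o S_h) + O(h^2), where S_h is one Euler step.  Hence the
   distance sup |mu_t(psi) - nu_t(psi)| over psi with first and second y-derivatives
   bounded by 1 grows by a factor 1 + O(h) plus O(h^2) over a time h, and letting h -> 0
   keeps it at 0.  All test functions are taken in an algebra built from linear maps,
   products and smooth one-variable functions; it is rich enough to separate measures. *)
Require Import Defs.
From mathcomp Require Import all_boot all_order all_algebra.
From mathcomp Require Import all_classical all_reals all_analysis.
From mathcomp Require Import measurable_realfun.
From mathcomp Require Import ring lra.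
Import Order.TTheory GRing.Theory Num.Theory.
Import numFieldNormedType.Exports.
Local Open Scope classical_set_scope.
Local Open Scope ring_scope.
Set Implicit Arguments.
Unset Strict Implicit.
Unset Printing Implicit Defensive.

(** * Smooth functions of one variable *)

(** Uniqueness is Eulerian: no flow is attached to a given solution; only integrals of test
    functions are compared. The first y-derivative of a test function measures the effect of moving
    a point, the second the Taylor error of a step; theta-derivatives never enter, theta being a
    parameter. The nonlocal term is harmless because the first coordinate is itself an admissible
    test function, so the distance controls the difference of the two means. For existence, the
    unknown is a curve of functions on the whole plane, because the mean couples all
    characteristics; measurability in the initial point suffices to push mu0 forward. A second-order
    Taylor inequality takes the place of the differential equation: it survives uniform limits and
    averaging against a measure, and it yields both differentiability in time and the integral
    equation. Near the boundary of Omega, where y^p may be singular and where admissible test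
    functions must vanish, cut-offs equal to one around the box bridge the gap. *)

Section smooth1.
Context {R : realType}.
Implicit Types f g : R -> R.

(** Directional derivatives are read off on the line through [x], so that every later rule reduces
    to one-variable calculus. *)
Lemma is_derive_line (V : normedModType R) (f : V -> R) x v d :
  is_derive (0 : R) (1 : R) (fun h : R => f (h *: v + x)) d <-> is_derive x v f d.
Proof.
have e : 'D_(1 : R) (fun h : R => f (h *: v + x)) 0 = 'D_v f x.
  rewrite /derive; set g1 := fun h => h^-1 *: _; set g2 := fun h => h^-1 *: _.
  suff -> : g1 = g2 by [].
  by rewrite funeqE /g1 /g2 => h /=; rewrite addr0 scale0r add0r [_%:A]mulr1.
split=> -[D E].
  by apply: DeriveDef; [exact: (proj2 (derivable1P f x v) D)|rewrite -e].
by apply: DeriveDef; [exact: (proj1 (derivable1P f x v) D)|rewrite e].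
Qed.

Lemma is_derive_comp1 (V : normedModType R) (a : R -> R) (f : V -> R) x v da df :
  is_derive (f x) (1 : R) a da -> is_derive x v f df ->
  is_derive x v (fun x => a (f x)) (da * df).
Proof.
move=> [Da Ea] /is_derive_line [Df Ef]; apply/is_derive_line.
set g := fun h : R => f (h *: v + x) in Df Ef *.
have g0 : g 0 = f x by rewrite /g scale0r add0r.
rewrite -g0 in Da Ea.
have Dg := proj1 (derivable1_diffP g 0) Df.
have Dag := proj1 (derivable1_diffP a (g 0)) Da.
have D := proj2 (derivable1_diffP (a \o g) 0) (differentiable_comp Dg Dag).
apply: DeriveDef; first exact: D.
rewrite -derive1E; apply: (etrans (derive1_comp Df Da)).
by rewrite !derive1E; congr (_ * _).
Qed.

(** Continuity of the last derivative is not recorded: in [smooth1] it follows from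
    differentiability at the next order. *)
Fixpoint dn (k : nat) f : Prop :=
  if k is k'.+1 then (forall x, derivable f x 1) /\ dn k' (derive1 f) else True.

Definition smooth1 f := forall k, dn k f.

Lemma dnS k f g : (forall x, is_derive x (1:R) f (g x)) -> dn k g -> dn k.+1 f.
Proof.
move=> fg kg; split=> [x|]; first by case: (fg x).
suff -> : (derive1 f) = g by [].
by apply/funext => x; rewrite derive1E; apply: derive_val.
Qed.

Lemma dnW k f : dn k.+1 f -> dn k f.
Proof. by elim: k f => [//|k IH] f [df kf]; split => //; exact: IH. Qed.

Lemma dn_is_derive k f : dn k.+1 f -> forall x, is_derive x (1:R) f ((derive1 f) x).
Proof. by case=> df _ x; rewrite derive1E; exact/derivableP. Qed.

Lemma dn_cst k (c : R) : dn k (cst c).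
Proof.
elim: k c => [//|k IH] c; have H x : is_derive x (1:R) (cst c) 0 by exact: is_derive_cst.
exact: (dnS H (IH 0)).
Qed.

Lemma dn_id k : dn k (@id R).
Proof.
case: k => [//|k]; have H x : is_derive x (1:R) id (cst 1 x) by exact: is_derive_id.
exact: (dnS H (dn_cst k 1)).
Qed.

Lemma dnD k f g : dn k f -> dn k g -> dn k (f + g).
Proof.
elim: k f g => [//|k IH] f g kf kg.
apply: (@dnS _ _ ((derive1 f) + (derive1 g))); last by apply: IH; [case: kf|case: kg].
by move=> x; have := dn_is_derive kf x; have := dn_is_derive kg x => *; exact: is_deriveD.
Qed.

Lemma dnM k f g : dn k f -> dn k g -> dn k (f * g).
Proof.
elim: k f g => [//|k IH] f g kf kg.
apply: (@dnS _ _ (f * (derive1 g) + g * (derive1 f))).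
  move=> x; have := dn_is_derive kf x; have := dn_is_derive kg x => *.
  exact: is_deriveM.
by apply: dnD; apply: IH; first [exact: dnW|by case: kf|by case: kg].
Qed.

Lemma dn_comp k f g : dn k f -> dn k g -> dn k (f \o g).
Proof.
elim: k f g => [//|k IH] f g kf kg.
have H x : is_derive x (1:R) (f \o g) (((derive1 f \o g) * derive1 g) x).
  exact: (is_derive_comp1 (dn_is_derive kf (g x)) (dn_is_derive kg x)).
apply: (dnS H); apply: dnM; last by case: kg.
by apply: IH; [case: kf|exact: dnW].
Qed.

Lemma dnV k g : (forall x, g x != 0) -> dn k g -> dn k (fun x => (g x)^-1).
Proof.
move=> g0; elim: k => [//|k IH] kg.
have kV : dn k (fun x => (g x)^-1) by exact/IH/dnW.
apply: (@dnS _ _ (cst (-1) * ((fun x => (g x)^-1) * (fun x => (g x)^-1)) * (derive1 g))).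
  move=> x; have := dn_is_derive kg x => dg.
  by apply: (is_derive_eq (is_deriveV (g0 x) dg)); rewrite /cst /GRing.mul/= mulN1r expr2 invfM.
apply: dnM; last by case: kg.
by apply: dnM; [exact: dn_cst|exact: dnM].
Qed.

Lemma smooth1_derive f : smooth1 f -> smooth1 (derive1 f).
Proof. by move=> sf k; have [] := sf k.+1. Qed.

Lemma smooth1_is_derive f : smooth1 f -> forall x, is_derive x (1:R) f ((derive1 f) x).
Proof. by move=> sf; exact: (@dn_is_derive 0). Qed.

Lemma smooth1_continuous f : smooth1 f -> continuous f.
Proof.
move=> sf x; apply: differentiable_continuous; apply/derivable1_diffP.
by case: (smooth1_is_derive sf x).
Qed.

(* The powers x^-n make the family stable under derivation. *)
Definition flat (n : nat) (x : R) : R :=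
  if 0 < x then x ^- n * expR (- x^-1) else 0.

(** The term of degree n+2 in the series of exp(1/x) beats x^-n and leaves a factor x^2, which is
    enough for a zero derivative at the origin. *)
Lemma flat_le n (x : R) : 0 <= x -> `|flat n x| <= (n.+2)`!%:R * x ^+ 2.
Proof.
rewrite le_eqVlt => /predU1P[<-|x0]; rewrite /flat ?ltxx ?normr0 ?expr0n ?mulr0 //.
rewrite x0 ger0_norm; last by rewrite mulr_ge0 ?expR_ge0// invr_ge0 exprn_ge0// ltW.
rewrite expRN ler_pdivrMr ?expR_gt0//.
have := @expR_ge1Dxn _ x^-1 n.+1; rewrite invr_ge0 (ltW x0) => /(_ isT) h.
have : (x^-1) ^+ n.+2 / n.+2`!%:R <= expR x^-1 by rewrite (le_trans _ h)// lerDr.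
move=> {}h; apply: (@le_trans _ _ (n.+2`!%:R * x ^+ 2 * (x^-1 ^+ n.+2 / n.+2`!%:R))).
  rewrite le_eqVlt; apply/orP; left; apply/eqP.
  have f0 : n.+2`!%:R != 0 :> R by rewrite pnatr_eq0 -lt0n fact_gt0.
  rewrite -!exprVn -[n.+2]addn2 exprD; field.
  by rewrite -addn2 in f0; rewrite f0 gt_eqF.
by rewrite ler_wpM2l// mulr_ge0// exprn_ge0// ltW.
Qed.

Lemma flat0 n (x : R) : x <= 0 -> flat n x = 0.
Proof. by rewrite /flat ltNge => ->. Qed.

Lemma flat_gt0 n (x : R) : 0 < x -> 0 < flat n x.
Proof. by move=> x0; rewrite /flat x0 mulr_gt0 ?expR_gt0// invr_gt0 exprn_gt0. Qed.

Lemma flat_ge0 n (x : R) : 0 <= flat n x.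
Proof.
by case: (leP x 0) => [/flat0->//|/flat_gt0/ltW].
Qed.

Lemma is_derive_sq_bound f (C : R) : (\forall h \near (0 : R), `|f h| <= C * h ^+ 2) ->
  is_derive (0 : R) (1 : R) f 0.
Proof.
move=> fC.
have f0 : f 0 = 0.
  by apply/eqP; rewrite -normr_le0 (le_trans (nbhs_singleton fC))// expr0n mulr0.
have cv : (fun h : R => h^-1 *: ((f \o shift 0) (h *: 1) - f 0)) @ 0^' --> 0.
  apply/cvgrPdist_le => e e0; near=> h.
  have h0 : h != 0 by near: h; exact: nbhs_dnbhs_neq.
  have hC : `|f h| <= C * h ^+ 2 by near: h; exact: cvg_within.
  rewrite sub0r normrN /= f0 subr0 addr0 [h *: 1]mulr1 normrZ normfV.
  rewrite ler_pdivrMl ?normr_gt0// (le_trans hC)//.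
  rewrite -[h ^+ 2]ger0_norm ?sqr_ge0// normrX expr2.
  rewrite mulrA [leRHS]mulrC ler_wpM2r//.
  apply: (@le_trans _ _ (`|C| * `|h|)); first by rewrite ler_wpM2r// ler_norm.
  have : `|h| <= e / (`|C| + 1).
    near: h; apply: dnbhs0_le; rewrite divr_gt0// ltr_wpDl//.
  rewrite ler_pdivlMr ?ltr_wpDl// => /(le_trans _); apply.
  by rewrite mulrC ler_wpM2l// lerDl.
have df : derivable f 0 1 by apply/cvg_ex; exists 0.
by apply: DeriveDef => //; apply/cvg_lim.
Unshelve. all: by end_near. Qed.

(** For x > 0 this is the product rule, for x < 0 the function is locally zero, and at 0 the
    quadratic bound [flat_le] applies. *)
Lemma flat_is_derive n (x : R) :
  is_derive x (1 : R) (flat n) ((cst (- n%:R) * flat n.+1 + flat n.+2) x).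
Proof.
rewrite [X in is_derive _ _ _ X]/GRing.add/= [X in X + _]/GRing.mul/= /cst.
case: (ltgtP x 0) => [x0|x0|->].
- rewrite !flat0 ?ltW// mulr0 addr0.
  have := is_derive_cst (0 : R) x (1 : R).
  apply: near_eq_is_derive.
  near=> z; rewrite flat0// /cst//.
  by apply: ltW; near: z; exact: lt_nbhsl.
- have x1 : x != 0 by rewrite gt_eqF.
  have dV : is_derive x (1 : R) (fun z : R => z^-1) (- x ^- 2).
    have H := @is_deriveV _ (@id R) x 1 1 x1 (is_derive_id x 1).
    by apply: (is_derive_eq H); rewrite [LHS]mulr1.
  have dE : is_derive x (1 : R) (fun z : R => expR (- z^-1)) (x ^- 2 * expR (- x^-1)).
    have dN : is_derive x (1 : R) (fun z : R => - z^-1) (x ^- 2).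
      by apply: (is_derive_eq (is_deriveN dV)); rewrite opprK.
    have := is_derive_comp1 (a := expR) (f := fun z : R => - z^-1) (is_derive_expR (- x^-1)) dN.
    by rewrite mulrC.
  have dX : is_derive x (1 : R) (fun z : R => z^-1 ^+ n) (n%:R * x^-1 ^+ n.-1 * (- x ^- 2)).
    have H := is_deriveX n dV.
    rewrite (_ : (fun z : R => z^-1 ^+ n) = (fun z : R => z^-1) ^+ n); last first.
      by apply/funext => z; rewrite exprfctE.
    by apply: (is_derive_eq H); rewrite /GRing.scale/= -mulr_natl.
  have := is_deriveM dX dE.
  move/(near_eq_is_derive (f := (fun z : R => z^-1 ^+ n) * (fun z : R => expR (- z^-1))) (g := flat n)) => H.
  apply: (is_derive_eq (H _)).
  + near=> z; rewrite /flat; have -> : 0 < z by near: z; exact: lt_nbhsr.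
    by rewrite /GRing.mul/= exprVn.
  + rewrite /flat x0 -!exprVn /GRing.scale/=.
    by case: n {dX H} => [|m] /=; rewrite ?exprS; ring.
- rewrite !flat0// mulr0 addr0.
  apply: (@is_derive_sq_bound _ (n.+2)`!%:R); near=> h.
  have [h0|h0] := leP 0 h; first exact: flat_le.
  by rewrite (flat0 _ (ltW h0)) normr0 mulr_ge0// sqr_ge0.
Unshelve. all: by end_near. Qed.

Lemma smooth1_flat n : smooth1 (flat n).
Proof.
move=> k; elim: k n => [//|k IH] n.
apply: (dnS (flat_is_derive n)); apply: dnD => //.
by apply: dnM => //; exact: dn_cst.
Qed.

(** The usual smooth transition from 0 to 1 on [0, 1]; the denominator is positive because [x] and
    [1 - x] are never both nonpositive. *)
Definition step (x : R) : R := flat 0 x / (flat 0 x + flat 0 (1 - x)).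

Let step_den (x : R) : 0 < flat 0 x + flat 0 (1 - x).
Proof.
case: (ltP 0 x) => x0; first by rewrite ltr_pwDl ?flat_gt0 ?flat_ge0.
by rewrite ltr_wpDl ?flat_ge0// flat_gt0// subr_gt0 (le_lt_trans x0).
Qed.

Lemma step0 (x : R) : x <= 0 -> step x = 0.
Proof. by move=> x0; rewrite /step flat0// mul0r. Qed.

Lemma step1 (x : R) : 1 <= x -> step x = 1.
Proof.
move=> x1; rewrite /step (@flat0 _ (1 - x)) ?subr_le0// addr0 divff// gt_eqF// flat_gt0//.
exact: lt_le_trans x1.
Qed.

Lemma step_ge0 (x : R) : 0 <= step x.
Proof. by rewrite divr_ge0 ?flat_ge0// ltW. Qed.

Lemma step_le1 (x : R) : step x <= 1.
Proof. by rewrite ler_pdivrMr// mul1r lerDl flat_ge0. Qed.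

Lemma smooth1_affine (u v : R) : smooth1 (fun x => u * x + v).
Proof.
move=> k; rewrite (_ : (fun x => _) = cst u * id + cst v)//.
by apply: dnD; [apply: dnM; [exact: dn_cst|exact: dn_id]|exact: dn_cst].
Qed.

Lemma smooth1_step : smooth1 step.
Proof.
move=> k; rewrite (_ : step = flat 0 * (fun x => (flat 0 x + flat 0 (1 - x))^-1))//.
apply: dnM; first exact: smooth1_flat.
apply: dnV => [x|]; first by rewrite gt_eqF.
apply: dnD; first exact: smooth1_flat.
rewrite (_ : (fun x : R => _) = flat 0 \o (fun x => -1 * x + 1)).
  by apply: dn_comp; [exact: smooth1_flat|exact: smooth1_affine].
by apply/funext => x /=; rewrite mulN1r addrC.
Qed.

(** The slope [k] sets the width of the transition: the function is 1 on [c, d] and vanishes outside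
    the 1/k-neighbourhood of that interval. *)
Definition cutoff (k c d x : R) : R := step (k * (x - c) + 1) * step (k * (d - x) + 1).

Lemma smooth1_cutoff k c d : smooth1 (cutoff k c d).
Proof.
move=> n; rewrite (_ : cutoff k c d = (step \o (fun x => k * x + (1 - k * c))) *
   (step \o (fun x => (- k) * x + (1 + k * d)))).
  by apply: dnM; (apply: dn_comp; [exact: smooth1_step|exact: smooth1_affine]).
apply/funext => x; rewrite /cutoff.
change (step (k * (x - c) + 1) * step (k * (d - x) + 1) =
  step (k * x + (1 - k * c)) * step (- k * x + (1 + k * d))).
by congr (step _ * step _); ring.
Qed.

Lemma cutoff1 k c d x : 0 <= k -> c <= x <= d -> cutoff k c d x = 1.
Proof.
move=> k0 /andP[cx xd]; rewrite /cutoff !step1 ?mulr1//.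
all: by rewrite lerDr mulr_ge0// subr_ge0.
Qed.

Lemma cutoff_neq0 k c d x : 0 < k -> cutoff k c d x != 0 -> c - k^-1 < x < d + k^-1.
Proof.
move=> k0; apply: contra_neqT; rewrite negb_and -!leNgt /cutoff.
have kk : k * k^-1 = 1 by rewrite divff// gt_eqF.
move=> /orP[] h.
  rewrite (@step0 (k * (x - c) + 1)) ?mul0r//.
  by have := ler_wpM2l (ltW k0) h; rewrite mulrBr kk; lra.
rewrite (@step0 (k * (d - x) + 1)) ?mulr0//.
by have := ler_wpM2l (ltW k0) h; rewrite mulrDr kk; lra.
Qed.

(** The derivative is a sum of two products of the same shape, with (f', q) and (q f, q - 1), so the
    induction generalizes over [f] and [q]. The power is differentiated at positive points only; at
    nonpositive ones the product is locally zero. *)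
Lemma dn_cut_powR n (f : R -> R) (c q : R) : 0 < c -> smooth1 f ->
  (forall x, x <= c -> f x = 0) -> dn n (fun x => f x * x `^ q).
Proof.
move=> c0; elim: n q f => [//|n IH] q f sf f0.
have f'0 x : x <= c -> derive1 f x = 0.
  have sub z : z < c -> derive1 f z = 0.
    move=> zc; rewrite derive1E; have H := is_derive_cst (0 : R) z (1 : R).
    apply: derive_val; apply: near_eq_is_derive H => //.
    near=> w; rewrite f0// ltW//; near: w; exact: lt_nbhsl.
  (* At the end point [c] the derivative vanishes as a left limit, by continuity of f'. *)
  rewrite le_eqVlt => /predU1P[->|]; last exact: sub.
  have cl : derive1 f w @[w --> c^'-] --> derive1 f c.
    by apply: cvg_at_left_filter; exact: smooth1_continuous (smooth1_derive sf) c.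
  have cl0 : derive1 f w @[w --> c^'-] --> (0 : R).
    by apply: cvg_near_cst; near=> w; rewrite sub.
  exact: (cvg_unique _ cl cl0).
have H x : is_derive x (1 : R) (fun x => f x * x `^ q)
  ((fun x => (derive1 f x * x `^ q) + (q * f x) * x `^ (q - 1)) x).
  case: (ltP 0 x) => x0.
    have d1 := smooth1_is_derive sf x.
    have d2 := is_derive1_powR q x0.
    by apply: (is_derive_eq (is_deriveM d1 d2)); rewrite /GRing.scale/=; ring.
  have xc : x < c by exact: le_lt_trans c0.
  rewrite f'0 ?f0 ?ltW// mul0r mulr0 mul0r addr0.
  have := is_derive_cst (0 : R) x (1 : R); apply: near_eq_is_derive => //.
  near=> w; rewrite f0 ?mul0r// ltW//; near: w; exact: lt_nbhsl.
apply: (dnS H); apply: dnD; first exact: (IH _ _ (smooth1_derive sf)).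
apply: (IH _ (fun x => q * f x)).
  move=> k; exact: (dnM (dn_cst k q) (sf k)).
by move=> x xc; rewrite f0// mulr0.
Unshelve. all: by end_near. Qed.

Lemma smooth_powR (a b q : R) : 0 < a -> exists2 g, smooth1 g &
  forall x, a <= x <= b -> g x = x `^ q.
Proof.
(* The slope 2/a makes the cut-off vanish on x <= a/2, away from the singularity of the power at
   0. *)
move=> a0; exists (fun x => cutoff (2 / a) a b x * x `^ q); last first.
  by move=> x xab; rewrite cutoff1 ?mul1r// divr_ge0// ltW.
move=> n; apply: (@dn_cut_powR _ _ (a / 2)); first by rewrite divr_gt0.
  exact: smooth1_cutoff.
move=> x xa; apply: contra_leP xa => //; rewrite -?ltNge.
have k0 : 0 < 2 / a by rewrite divr_gt0.
move=> /eqP /(cutoff_neq0 k0) /andP[+ _].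
by rewrite invfM invrK mulrC => h; apply: le_lt_trans h; lra.
Qed.
End smooth1.

(** * An algebra of smooth functions *)

Section alg.
Context {R : realType}.

Lemma is_derive_linear (V : normedModType R) (l : V -> R) :
  (forall (h : R) x v, l (h *: v + x) = h * l v + l x) ->
  forall x v, is_derive x v l (l v).
Proof.
move=> ll x v; apply/is_derive_line.
rewrite (_ : (fun h : R => _) = (fun h => l v * h + l x)); last first.
  by apply/funext => h; rewrite ll mulrC.
have H := smooth1_is_derive (smooth1_affine (l v) (l x)) 0.
apply: (is_derive_eq H); rewrite derive1E.
have h1 : is_derive (0:R) (1:R) ((cst (l v) * id) + cst (l x)) (l v).
  have := is_deriveD (is_deriveM (is_derive_cst (l v) (0:R) (1:R)) (is_derive_id (0:R) (1:R))) (is_derive_cst (l x) (0:R) (1:R)).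
  move=> K; apply: (is_derive_eq K).
  by rewrite /GRing.scale/= /cst mulr1 mulr0 !addr0.
exact: (@derive_val _ _ _ _ _ _ _ h1).
Qed.

(* A class of smooth functions closed under the algebra operations, smooth
   post-composition and directional derivatives, so that no chain rule in
   several variables is needed. *)
Inductive alg (V : normedModType R) : (V -> R) -> Prop :=
| alg_lin (l : V -> R) of continuous l &
    (forall (h : R) x v, l (h *: v + x) = h * l v + l x) : alg l
| alg_cst (c : R) : alg (cst c)
| alg_add (f g : V -> R) of alg f & alg g : alg (fun x => f x + g x)
| alg_mul (f g : V -> R) of alg f & alg g : alg (fun x => f x * g x)
| alg_comp (a : R -> R) (f : V -> R) of smooth1 a & alg f : alg (fun x => a (f x)).

Lemma alg_continuous (V : normedModType R) (f : V -> R) : alg f -> continuous f.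
Proof.
elim=> {f} [l //|c|f g _ cf _ cg|f g _ cf _ cg|a f sa _ cf] x.
- exact: cvg_cst.
- exact: cvgD (cf x) (cg x).
- exact: cvgM (cf x) (cg x).
- have H : {for x, continuous (a \o f)}.
    by apply: continuous_comp; [exact: cf|exact: smooth1_continuous].
  exact: H.
Qed.

Lemma alg_is_derive (V : normedModType R) (f : V -> R) v : alg f ->
  exists2 g, alg g & forall x, is_derive x v f (g x).
Proof.
elim=> {f} [l cl dl|c|f g _ [f' af' df] _ [g' ag' dg]|f g af [f' af' df] ag [g' ag' dg]|a f sa af [f' af' df]].
- by exists (cst (l v)) => [|x]; [exact: alg_cst|exact: is_derive_linear].
- by exists (cst 0) => [|x]; [exact: alg_cst|exact: is_derive_cst].
- exists (fun x => f' x + g' x) => [|x]; first exact: alg_add.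
  exact: (is_deriveD (df x) (dg x)).
- exists (fun x => f x * g' x + g x * f' x) => [|x].
    by apply: alg_add; exact: alg_mul.
  exact: (is_deriveM (df x) (dg x)).
- exists (fun x => derive1 a (f x) * f' x) => [|x].
    by apply: alg_mul => //; apply: alg_comp => //; exact: smooth1_derive.
  by apply: is_derive_comp1 => //; exact: smooth1_is_derive.
Qed.

Lemma alg_derive (V : normedModType R) (f : V -> R) v : alg f -> alg ('D_v f).
Proof.
move=> /(alg_is_derive v)[g ag dg]; suff -> : 'D_v f = g by [].
by apply/funext => x; exact: derive_val.
Qed.

Lemma alg_derivable (V : normedModType R) (f : V -> R) x v : alg f -> derivable f x v.
Proof. by move=> /(alg_is_derive v)[g ag dg]; case: (dg x). Qed.

Lemma alg_is_deriveE (V : normedModType R) (f : V -> R) x v : alg f -> is_derive x v f ('D_v f x).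
Proof. by move=> af; exact/derivableP/alg_derivable. Qed.

Lemma alg_smooth (V : normedModType R) (f : V -> R) : alg f -> smooth f.
Proof.
move=> af k; elim: k f af => [|k IH] f af /=; first exact: alg_continuous.
split=> [|v]; first exact: alg_continuous.
by split=> [x|]; [exact: alg_derivable|exact/IH/alg_derive].
Qed.

(** Only the linear generators see the argument directly; the other constructors commute with
    substitution. *)
Lemma alg_subst (V W : normedModType R) (P : W -> V) (f : V -> R) :
  (forall l : V -> R, continuous l -> (forall (h : R) x v, l (h *: v + x) = h * l v + l x) -> alg (l \o P)) ->
  alg f -> alg (f \o P).
Proof.
move=> lP; elim=> {f} [l cl dl|c|f g _ af _ ag|f g _ af _ ag|a f sa _ af].
- exact: lP.
- exact: (@alg_cst W c).
- exact: (alg_add af ag).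
- exact: (alg_mul af ag).
- exact: (alg_comp sa af).
Qed.

Lemma alg_fst : alg (fst : R * R -> R).
Proof. by apply: alg_lin => [x|]; [exact: cvg_fst|by []]. Qed.

Lemma alg_snd : alg (snd : R * R -> R).
Proof. by apply: alg_lin => [x|]; [exact: cvg_snd|by []]. Qed.

Lemma alg_time : alg (fst : R * (R * R) -> R).
Proof. by apply: alg_lin => [x|]; [exact: cvg_fst|by []]. Qed.

Lemma alg_space (f : R * R -> R) : alg f -> alg (f \o (snd : R * (R * R) -> R * R)).
Proof.
apply: alg_subst => l cl ll; apply: alg_lin => [x|].
  apply: continuous_comp; [exact: cvg_snd|exact: cl].
by move=> h x v /=; rewrite ll.
Qed.
End alg.

(** * Measures concentrated on a box *)

Lemma compact_norm_bound {R : realType} (T : topologicalType) (K : set T) (f : T -> R) :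
  compact K -> {within K, continuous f} ->
  exists2 C, 0 <= C & forall x, K x -> `|f x| <= C.
Proof.
move=> cK cf; have [->|/set0P K0] := eqVneq K set0; first by exists 0.
have [x1 _ h1] := compact_EVT_max K0 cK cf.
have [x2 _ h2] := compact_EVT_min K0 cK cf.
exists (`|f x1| + `|f x2|) => [|x Kx]; first by rewrite addr_ge0.
have := h1 x (mem_set Kx); have := h2 x (mem_set Kx).
have := ler_norm (f x1); have := ler_norm (- f x2); rewrite normrN.
have := normr_ge0 (f x1); have := normr_ge0 (f x2).
by rewrite ler_norml; lra.
Qed.

Section plane.
Context {R : realType}.
Notation plane := (measurableTypeR R * measurableTypeR R)%type.
Implicit Types (U A : set (R * R)) (f g : R * R -> R).

(** A countable base of the plane made of measurable rectangles. It makes open sets measurable for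
    the product sigma-algebra and lets null open sets be collected in a countable union. *)
Definition qbox (q : (rat * rat) * (rat * rat)) : set (R * R) :=
  `]ratr q.1.1, ratr q.1.2[%classic `*` `]ratr q.2.1, ratr q.2.2[%classic.

Lemma open_qbox U x : open U -> U x -> exists2 q, qbox q x & qbox q `<=` U.
Proof.
move=> oU Ux; have /nbhs_ballP[e e0 xU] : nbhs x U by exact: open_nbhs_nbhs.
rewrite /= in e0.
have lt1 (y : R) : y - e < y by rewrite ltrBlDr ltrDl.
have lt2 (y : R) : y < y + e by rewrite ltrDl.
have [q1 h1] := rat_in_itvoo (lt1 x.1); have [q2 h2] := rat_in_itvoo (lt2 x.1).
have [q3 h3] := rat_in_itvoo (lt1 x.2); have [q4 h4] := rat_in_itvoo (lt2 x.2).
move: h1 h2 h3 h4; rewrite !in_itv/= => /andP[a1 a2] /andP[a3 a4] /andP[b1 b2] /andP[b3 b4].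
exists ((q1, q2), (q3, q4)); first by split; rewrite /= in_itv/=; apply/andP.
move=> z [/=]; rewrite !in_itv/= => /andP[c1 c2] /andP[d1 d2]; apply: xU.
by split; rewrite /ball/= ltr_distlC; apply/andP; split;
  [exact: lt_trans c1|exact: lt_trans a4|exact: lt_trans d1|exact: lt_trans b4].
Qed.

Lemma measurable_rectangle (I J : interval R) :
  measurable ([set` I] `*` [set` J] : set plane).
Proof. by apply: measurableX; exact: measurable_itv. Qed.

Lemma measurable_qbox q : measurable (qbox q : set plane).
Proof. exact: measurable_rectangle. Qed.

Lemma open_measurable2 U : open U -> measurable (U : set plane).
Proof.
move=> oU.
have -> : U = \bigcup_(q in [set: (rat * rat) * (rat * rat)])
    (if `[<qbox q `<=` U>] then qbox q else set0).
  apply/seteqP; split=> [x Ux|x [q _]].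
    by have [q qx qU] := open_qbox oU Ux; exists q => //; rewrite asboolT.
  by case: ifPn => // /asboolP; exact.
apply: (@countable_bigcupT_measurable _ plane); first exact: countableP.
by move=> q; case: ifPn => // _; exact: measurable_qbox.
Qed.

Lemma continuous_measurable2 f : continuous f ->
  measurable_fun [set: plane] (f : plane -> R).
Proof.
move=> cf; apply: (measurability _ (RGenOpens.measurableE R)).
move=> _ [_ [a [b ->] <-]]; rewrite setTI; apply: open_measurable2.
by move/continuousP : cf; apply; exact: interval_open.
Qed.

(** Each point outside the support has a null open neighbourhood, hence lies in a null rational
    rectangle; there are countably many of these. *)
Lemma supp_null (P : @planar_probability R) A : supp P `<=` A -> measurable (A : set plane) ->
  P (~` A) = 0%E.
Proof.
move=> sA mA; apply/measure_negligible; first exact: measurableC.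
pose F n : set plane := if @unpickle ((rat * rat) * (rat * rat))%type n is Some q
  then (if `[<P (qbox q) = 0%E>] then qbox q else set0) else set0.
have FE q : P (qbox q) = 0%E -> F (pickle q) = qbox q.
  by move=> h; rewrite /F pickleK; case: asboolP.
apply: (@negligibleS _ _ _ P (\bigcup_k F k)).
  move=> x /= nAx; have /existsNP[U /not_implyP[oU /not_implyP[Ux]]] : ~ supp P x by move=> /sA.
  move=> PU; have [q qx qU] := open_qbox oU Ux.
  exists (pickle q); first exact: I.
  suff h : P (qbox q) = 0%E by rewrite FE.
  apply/eqP; rewrite eq_le measure_ge0 andbT; apply: (@le_trans _ _ (P U)).
    by apply: le_measure => //; rewrite inE; [exact: measurable_qbox|exact: open_measurable2].
  by rewrite leNgt; apply/negP.
apply: negligible_bigcup => k; rewrite /F; case: unpickle => [q|]; last exact: negligible_set0.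
case: ifPn => [/asboolP q0|_]; last exact: negligible_set0.
by apply/negligibleP => //; exact: measurable_qbox.
Qed.

Lemma closed_supp (P : @planar_probability R) : closed (supp P).
Proof.
move=> x cx U oU Ux; have [y [sy Uy]] := cx U (open_nbhs_nbhs (conj oU Ux)).
exact: sy.
Qed.

Lemma supp_sub (P : @planar_probability R) A : closed A -> P (~` A) = 0%E -> supp P `<=` A.
Proof.
move=> cA P0 x sx; apply: contrapT => nAx.
by have := sx (~` A) (closed_openC cA) nAx; rewrite P0 ltxx.
Qed.

Definition box (a b c d : R) : set (R * R) := `[a, b]%classic `*` `[c, d]%classic.

Lemma boxP a b c d (x : R * R) : box a b c d x <-> (a <= x.1 <= b /\ c <= x.2 <= d).
Proof. by rewrite /box /= !in_itv. Qed.

Lemma compact_box a b c d : compact (box a b c d).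
Proof. by apply: compact_setX; exact: segment_compact. Qed.

Lemma closed_box a b c d : closed (box a b c d).
Proof. by apply: compact_closed; [exact: norm_hausdorff|exact: compact_box]. Qed.

Lemma measurable_box a b c d : measurable (box a b c d : set plane).
Proof. exact: measurable_rectangle. Qed.

Lemma open_Omega : open (@Omega R).
Proof.
have -> : @Omega R = fst @^-1` `]0, +oo[%classic `&` snd @^-1` `]0, +oo[%classic.
  by apply/seteqP; split => x; rewrite /Omega /= !in_itv/= !andbT.
apply: openI; apply: open_comp; try exact: interval_open.
  by move=> x _; exact: cvg_fst.
by move=> x _; exact: cvg_snd.
Qed.

Lemma measurable_Omega : measurable (@Omega R : set plane).
Proof. exact: (open_measurable2 open_Omega). Qed.

Section concentrated.
Variables (P : @planar_probability R) (B : set (R * R)).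
Hypothesis mB : measurable (B : set plane).
Hypothesis PB : P (~` B) = 0%E.

Lemma probability_carrier : P B = 1%E.
Proof.
by have := probability_setC P (measurableC mB); rewrite setCK PB sube0.
Qed.

(** Boundedness is asked on the carrier [B] only, so that coordinates and powers, unbounded on the
    plane, qualify; integrals over any larger domain [D] see only [B]. *)
Definition tame (f : R * R -> R) : Prop :=
  measurable_fun [set: plane] (f : plane -> R) /\ exists C, forall x, B x -> `|f x| <= C.

Section domain.
Variable D : set (R * R).
Hypotheses (mD : measurable (D : set plane)) (BD : B `<=` D).

Let DC : D `\` (~` B) = B.
Proof. by rewrite setDE setCK; apply/setIidPr. Qed.

Lemma tame_integrable f : tame f -> P.-integrable D (EFin \o f).
Proof.
move=> [mf [C fC]]; have mEf : @measurable_fun _ _ plane (\bar R) D (EFin \o f).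
  by apply/measurable_EFinP; exact: measurable_funTS.
apply/(negligible_integrable (measurableC mB) mD mEf PB); rewrite DC.
apply: measurable_bounded_integrable => //.
- by rewrite [X in (X < _)%E]probability_carrier ltry.
- exact: measurable_funTS.
- exists C; split; first exact: num_real.
  by move=> M CM x Bx; apply: le_trans (fC x Bx) (ltW CM).
Qed.

Lemma tame_integralE f : tame f ->
  (\int[P]_(x in D) (f x)%:E = (\int[P]_(x in D) f x)%:E)%E.
Proof. by move=> tf; rewrite fineK//; apply: integrable_fin_num => //; exact: tame_integrable. Qed.

Lemma tame_restrict f : tame f -> \int[P]_(x in D) f x = \int[P]_(x in B) f x.
Proof.
move=> tf; rewrite /Rintegral; congr fine.
by rewrite (negligible_integral (measurableC mB))// ?DC//; exact: tame_integrable.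
Qed.

End domain.

Lemma tameD f g : tame f -> tame g -> tame (fun x => f x + g x).
Proof.
move=> [mf [C fC]] [mg [E gE]]; split; first exact: measurable_funD.
exists (C + E) => x Bx; apply: le_trans (ler_normD _ _) _.
by rewrite lerD ?fC ?gE.
Qed.

Lemma tameM f g : tame f -> tame g -> tame (fun x => f x * g x).
Proof.
move=> [mf [C fC]] [mg [E gE]]; split; first exact: measurable_funM.
by exists (C * E) => x Bx; rewrite normrM ler_pM ?fC ?gE.
Qed.

Lemma tame_cst (c : R) : tame (fun=> c).
Proof. by split; [exact: measurable_cst|exists `|c|]. Qed.

Lemma tameB f g : tame f -> tame g -> tame (fun x => f x - g x).
Proof.
move=> tf tg; have := tameD tf (tameM (tame_cst (-1)) tg).
by under [X in tame X -> _]eq_fun do rewrite mulN1r.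
Qed.

Section domain2.
Variable D : set (R * R).
Hypotheses (mD : measurable (D : set plane)) (BD : B `<=` D).
Notation J f := (\int[P]_(x in D) f x).

Lemma meanD f g : tame f -> tame g -> J (fun x => f x + g x) = J f + J g.
Proof. by move=> tf tg; rewrite RintegralD//; exact: tame_integrable. Qed.

Lemma meanB f g : tame f -> tame g -> J (fun x => f x - g x) = J f - J g.
Proof. by move=> tf tg; rewrite RintegralB//; exact: tame_integrable. Qed.

Lemma meanZ k f : tame f -> J (fun x => k * f x) = k * J f.
Proof. by move=> tf; rewrite RintegralZl//; exact: tame_integrable. Qed.

Lemma mean_cst (k : R) : J (fun=> k) = k.
Proof.
rewrite (tame_restrict mD BD (tame_cst k)).
by transitivity (k * fine (P B)); [exact: Rintegral_cst|rewrite probability_carrier mulr1].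
Qed.

Lemma mean_le f g : tame f -> tame g -> (forall x, B x -> f x <= g x) -> J f <= J g.
Proof.
move=> tf tg fg; rewrite (tame_restrict mD BD tf) (tame_restrict mD BD tg).
by apply: le_Rintegral => //; apply: tame_integrable.
Qed.

Lemma mean_norm_le f (C : R) : tame f -> (forall x, B x -> `|f x| <= C) -> `|J f| <= C.
Proof.
move=> tf fC; rewrite ler_norml; apply/andP; split.
  rewrite -{1}(mean_cst (- C)); apply: mean_le => //; first exact: tame_cst.
  by move=> x /fC; rewrite ler_norml => /andP[].
rewrite -(mean_cst C); apply: mean_le => //; first exact: tame_cst.
by move=> x /fC; rewrite ler_norml => /andP[].
Qed.

Lemma mean_eq f g : tame f -> tame g -> (forall x, B x -> f x = g x) -> J f = J g.
Proof.
by move=> tf tg fg; apply/eqP; rewrite eq_le !mean_le// => x /fg->.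
Qed.

Lemma mean_dist_le f g (C : R) : tame f -> tame g -> (forall x, B x -> `|f x - g x| <= C) ->
  `|J f - J g| <= C.
Proof.
by move=> tf tg fgC; rewrite -meanB//; apply: mean_norm_le => //; exact: tameB.
Qed.

End domain2.
End concentrated.

Lemma tame_continuous a b c d f : continuous f -> tame (box a b c d) f.
Proof.
move=> cf; split; first exact: continuous_measurable2.
have [C C0 fC] := compact_norm_bound (@compact_box a b c d) (continuous_subspaceT cf).
by exists C.
Qed.

End plane.

(** * The velocity field and its Euler steps *)

Section calculus.
Context {R : realType}.

Lemma lipschitz_of_derive (g g' : R -> R) (a b C : R) :
  (forall r, a <= r <= b -> is_derive r (1 : R) g (g' r)) ->
  (forall r, a <= r <= b -> `|g' r| <= C) ->
  forall y z, a <= y <= b -> a <= z <= b -> `|g z - g y| <= C * `|z - y|.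
Proof.
move=> dg gC y z; wlog yz : y z / y <= z => [H yab zab|/andP[ay yb] /andP[az zb]].
  have [yz|/ltW zy] := leP y z; first exact: H.
  by rewrite distrC [X in _ * X]distrC; apply: H.
have sub r : r \in `[y, z] -> a <= r <= b.
  rewrite in_itv/= => /andP[yr rz].
  by rewrite (le_trans ay yr) (le_trans rz zb).
have [||r ryz ->] := @MVT_segment _ g g' y z yz.
- by move=> r ryz; apply: dg; apply: sub; exact: subset_itv_oo_cc ryz.
- apply: derivable_within_continuous => r /sub rab.
  by case: (dg r rab).
by rewrite normrM ler_wpM2r// gC// sub.
Qed.

(** The function r -> g r - g'(y) r has derivative g'(r) - g'(y), of size at most C |z - y| between
    y and z; one more use of the mean value theorem gives the bound, without the sharp factor
    1/2. *)
Lemma taylor2 (g g' g'' : R -> R) (a b C : R) :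
  (forall r, a <= r <= b -> is_derive r (1 : R) g (g' r)) ->
  (forall r, a <= r <= b -> is_derive r (1 : R) g' (g'' r)) ->
  (forall r, a <= r <= b -> `|g'' r| <= C) ->
  forall y z, a <= y <= b -> a <= z <= b ->
    `|g z - g y - (z - y) * g' y| <= C * (z - y) ^+ 2.
Proof.
move=> dg dg' gC y z yab zab.
have C0 : 0 <= C by apply: le_trans (gC y yab).
have sub r : Num.min y z <= r <= Num.max y z -> a <= r <= b.
  move: yab zab => /andP[ay yb] /andP[az zb] /andP[h1 h2].
  by rewrite (le_trans _ h1) ?le_min ?ay//= (le_trans h2)// ge_max yb.
pose k (r : R) := g r + (- g' y * r).
have dk r : Num.min y z <= r <= Num.max y z -> is_derive r (1 : R) k (g' r - g' y).
  move=> /sub rab; have d1 := dg r rab.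
  have d2 : is_derive r (1 : R) (fun r => - g' y * r) (- g' y).
    have := is_deriveZ (- g' y) (is_derive_id r (1 : R)).
    by move=> h; apply: (is_derive_eq h); rewrite [LHS]mulr1.
  exact: (is_deriveD d1 d2).
have kC r : Num.min y z <= r <= Num.max y z -> `|g' r - g' y| <= C * `|z - y|.
  move=> rmm; apply: le_trans (lipschitz_of_derive dg' gC yab (sub r rmm)) _.
  rewrite ler_wpM2l//; move: rmm; rewrite ge_min le_max => /andP[/orP[]h1 /orP[]h2].
  - by rewrite (_ : r = y) ?subrr ?normr0//; apply/eqP; rewrite eq_le h1 h2.
  - by rewrite !ger0_norm ?subr_ge0 ?(le_trans h1)// lerD2r.
  - by rewrite !ler0_norm ?subr_le0 ?(le_trans h1)// lerN2 lerD2r.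
  - by rewrite (_ : r = z)//; apply/eqP; rewrite eq_le h1 h2.
have ym : Num.min y z <= y <= Num.max y z by rewrite ge_min lexx le_max lexx.
have zm : Num.min y z <= z <= Num.max y z by rewrite ge_min lexx le_max lexx !orbT.
have := lipschitz_of_derive dk kC ym zm.
rewrite -mulrA -normrM -expr2 ger0_norm ?sqr_ge0//.
have -> : k z - k y = g z - g y - (z - y) * g' y.
  by rewrite /k; ring.
by [].
Qed.

Definition slice_derive (psi : R * R -> R) : R * R -> R := 'D_((1, 0) : R * R) psi.
Local Notation D1 := slice_derive.

Lemma is_derive_slice (psi : R * R -> R) (r t d : R) :
  is_derive r (1 : R) (fun r => psi (r, t)) d <-> is_derive ((r, t) : R * R) ((1, 0) : R * R) psi d.
Proof.
have E : (fun h : R => psi (h *: ((1, 0) : R * R) + (r, t))) =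
   (fun h : R => (fun r => psi (r, t)) (h *: (1 : R) + r)).
  by apply/funext => h; congr psi; congr pair; rewrite /= [_ *: 0]mulr0 add0r.
have [l1 l2] := @is_derive_line R _ (fun r => psi (r, t)) r 1 d.
have [k1 k2] := @is_derive_line R _ psi (r, t) (1, 0) d.
rewrite -E in l1 l2.
exact (conj (fun H => k1 (l2 H)) (fun H => l1 (k2 H))).
Qed.

Lemma alg_slice (psi : R * R -> R) (r t : R) : alg psi ->
  is_derive r (1 : R) (fun r => psi (r, t)) (D1 psi (r, t)).
Proof. by move=> apsi; apply/is_derive_slice/alg_is_deriveE. Qed.

Lemma alg_D1 psi : alg psi -> alg (D1 psi).
Proof. exact: alg_derive. Qed.

Lemma D1_eq (psi : R * R -> R) (x : R * R) d :
  is_derive x.1 (1 : R) (fun r => psi (r, x.2)) d -> D1 psi x = d.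
Proof.
by case: x => r t /= /is_derive_slice h; exact: (@derive_val _ _ _ _ _ _ _ h).
Qed.

Lemma D1D f g x : alg f -> alg g -> D1 (fun z => f z + g z) x = D1 f x + D1 g x.
Proof.
case: x => r t af ag; apply: D1_eq.
exact: (is_deriveD (alg_slice r t af) (alg_slice r t ag)).
Qed.

Lemma D1M f g x : alg f -> alg g -> D1 (fun z => f z * g z) x = f x * D1 g x + g x * D1 f x.
Proof.
case: x => r t af ag; apply: D1_eq.
exact: (is_deriveM (alg_slice r t af) (alg_slice r t ag)).
Qed.

Lemma D1_cst k x : D1 (fun=> k) x = 0.
Proof. by apply: D1_eq; exact: is_derive_cst. Qed.

Lemma D1_fst x : D1 fst x = 1.
Proof. by apply: D1_eq; exact: is_derive_id. Qed.

Definition shear (u : R * R -> R) (x : R * R) : R * R := (u x, x.2).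

(** A linear functional on the plane becomes l(1,0) u + l(0,1) theta after the substitution, which
    is again in the algebra. *)
Lemma alg_shear u psi : alg u -> alg psi -> alg (psi \o shear u).
Proof.
move=> au; apply: alg_subst => l cl ll.
rewrite (_ : l \o shear u = fun x => cst (l (1, 0)) x * u x + cst (l (0, 1)) x * snd x).
  by apply: alg_add; apply: alg_mul => //; try exact: alg_cst; exact: alg_snd.
apply/funext => x; rewrite /shear /cst/=.
have -> : (u x, x.2) = u x *: ((1, 0) : R * R) + (x.2 *: ((0, 1) : R * R) + 0).
  rewrite addr0; congr pair.
    by change (u x = u x * 1 + x.2 * 0); rewrite mulr1 mulr0 addr0.
  by change (x.2 = u x * 0 + x.2 * 1); rewrite mulr1 mulr0 add0r.
rewrite !ll.
have l0 : l 0 = 0.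
  have := ll 1 0 0; rewrite scaler0 add0r mul1r => /eqP.
  by rewrite -subr_eq0 opprD addrA subrr add0r oppr_eq0 => /eqP.
by rewrite l0 addr0 mulrC [X in _ + X]mulrC.
Qed.

Lemma D1_shear u psi x : alg u -> alg psi ->
  D1 (psi \o shear u) x = D1 psi (shear u x) * D1 u x.
Proof.
case: x => r t au ap; apply: D1_eq => /=.
exact: (is_derive_comp1 (alg_slice (u (r, t)) t ap) (alg_slice r t au)).
Qed.

End calculus.
Notation D1 := slice_derive.

Section field.
Context {R : realType}.
Variables (sigma a b c d : R) (g : R -> R).
Hypotheses (sigma0 : 0 < sigma) (a0 : 0 < a) (ab : a <= b).
Hypotheses (sg : smooth1 g) (ga : g a <= c) (gb : d <= g b).
Let B := box a b c d.

(* On B, the velocity is m + drift, with m the mean of the first coordinate. *)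
Definition drift (x : R * R) : R := sigma * (x.2 - g x.1) * x.1 - x.1.

Lemma alg_drift : alg drift.
Proof.
rewrite (_ : drift = fun x : R * R =>
  (cst sigma x * (snd x + cst (-1) x * g (fst x))) * fst x + cst (-1) x * fst x); last first.
  by apply/funext => x; rewrite /drift /cst/= !mulN1r.
have f1 := @alg_fst R; have f2 := @alg_snd R.
apply: alg_add; apply: alg_mul => //; try exact: alg_cst.
apply: alg_mul; first exact: alg_cst.
apply: alg_add => //; apply: alg_mul; first exact: alg_cst.
exact: (alg_comp sg f1).
Qed.

Lemma continuous_bound_box (f : R * R -> R) : continuous f -> exists2 C : R, 0 <= C & forall x, B x -> `|f x| <= C.
Proof.
move=> cf; exact: compact_norm_bound (@compact_box R a b c d) (continuous_subspaceT cf).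
Qed.

Lemma smooth1_lipschitz_box : exists2 L : R, 0 <= L &
  forall y z, a <= y <= b -> a <= z <= b -> `|g z - g y| <= L * `|z - y|.
Proof.
have cg' : continuous (derive1 g) by exact: smooth1_continuous (smooth1_derive sg).
have [L L0 gL] : exists2 C : R, 0 <= C & forall r, a <= r <= b -> `|derive1 g r| <= C.
  have [x1 _ h1] := EVT_max ab (continuous_subspaceT cg').
  have [x2 _ h2] := EVT_min ab (continuous_subspaceT cg').
  exists (`|derive1 g x1| + `|derive1 g x2|) => [|x Kx]; first by rewrite addr_ge0.
  have := h1 x; have := h2 x; rewrite in_itv/= => /(_ Kx) + /(_ Kx).
  have := ler_norm (derive1 g x1); have := ler_norm (- derive1 g x2); rewrite normrN.
  have := normr_ge0 (derive1 g x1); have := normr_ge0 (derive1 g x2).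
  by rewrite ler_norml; lra.
exists L => // y z.
apply: (@lipschitz_of_derive _ g (derive1 g)) => // r _.
exact: smooth1_is_derive.
Qed.

Definition euler (m h : R) (x : R * R) : R := x.1 + h * (m + drift x).

(** With L a Lipschitz constant of g, [ga] gives theta - g(y) >= -L (y - a), and m >= a; so the
    velocity at y is at least -(1 + sigma b L)(y - a), and a step of length at most 1/(1 + sigma b
    L) cannot cross a. The bound at b is symmetric. *)
Lemma euler_box : exists2 h0 : R, 0 < h0 <= 1 & forall (m h : R) x, a <= m <= b -> 0 <= h <= h0 ->
  B x -> a <= euler m h x <= b.
Proof.
have [L L0 gL] := smooth1_lipschitz_box.
have b0 : 0 < b by exact: lt_le_trans ab.
have K0 : 0 <= sigma * b * L by rewrite mulr_ge0// mulr_ge0// ltW.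
exists (1 + sigma * b * L)^-1.
  rewrite invr_gt0 ltr_wpDr//=; rewrite invf_le1 ?ltr_wpDr// lerDl//.
move=> m h [y t] /andP[am mb] /andP[h0 hh] /boxP[/= /andP[ay yb] /andP[ct td]].
rewrite /euler /drift/=.
have {}hh : h * (1 + sigma * b * L) <= 1.
  by rewrite -ler_pdivlMr ?ltr_wpDr// div1r.
have aab : a <= a <= b by rewrite lexx ab.
have bab : a <= b <= b by rewrite lexx ab.
have yab : a <= y <= b by rewrite ay yb.
have y0 : 0 < y by exact: lt_le_trans ay.
have e1 : - (L * (y - a)) <= t - g y.
  have := gL _ _ aab yab; rewrite (@ger0_norm _ (y - a)) ?subr_ge0// => /(le_trans (ler_norm _)) h1.
  by rewrite lerNl opprB (le_trans _ h1)// lerD2l lerN2 (le_trans ga).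
have e2 : t - g y <= L * (b - y).
  have := gL _ _ yab bab; rewrite (@ger0_norm _ (b - y)) ?subr_ge0// => /(le_trans (ler_norm _)) h1.
  by rewrite (le_trans _ h1)// lerD2r (le_trans td).
have sy : 0 <= sigma * y <= sigma * b.
  by rewrite (ltW (mulr_gt0 sigma0 y0)) /= ler_pM2l.
move: sy => /andP[sy0 syb].
have f1 : - (sigma * b * L * (y - a)) <= sigma * (t - g y) * y.
  have -> : sigma * (t - g y) * y = (sigma * y) * (t - g y) by ring.
  apply: le_trans (ler_wpM2l sy0 e1); rewrite mulrN lerN2 -mulrA.
  by rewrite ler_wpM2r// mulr_ge0// subr_ge0.
have f2 : sigma * (t - g y) * y <= sigma * b * L * (b - y).
  have -> : sigma * (t - g y) * y = (sigma * y) * (t - g y) by ring.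
  apply: le_trans (ler_wpM2l sy0 e2) _; rewrite -mulrA.
  by rewrite ler_wpM2r// mulr_ge0// subr_ge0.
have k1 : 0 <= (y - a) * (1 - h * (1 + sigma * b * L)).
  by rewrite mulr_ge0// subr_ge0.
have k2 : 0 <= (b - y) * (1 - h * (1 + sigma * b * L)).
  by rewrite mulr_ge0// subr_ge0.
have k3 : 0 <= h * (m - a) by rewrite mulr_ge0// subr_ge0.
have k4 : 0 <= h * (b - m) by rewrite mulr_ge0// subr_ge0.
have k5 := ler_wpM2l h0 f1; have k6 := ler_wpM2l h0 f2.
by apply/andP; split; lra.
Qed.

End field.

(** * Stability of the weak formulation *)

Section uniqueness.
Context {R : realType}.
Variables (sigma a b c d : R) (g : R -> R).
Hypotheses (sigma0 : 0 < sigma) (a0 : 0 < a) (c0 : 0 < c) (ab : a <= b).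
Hypotheses (sg : smooth1 g) (ga : g a <= c) (gb : d <= g b).
Let B := box a b c d.
Local Notation J P f := (\int[P]_(x in Omega) f x).
Local Notation drift := (drift sigma g).
Local Notation plane := (measurableTypeR R * measurableTypeR R)%type.
Implicit Types (s t h m r : R) (nu : R -> @planar_probability R) (psi f : R * R -> R).

Lemma box_Omega : B `<=` Omega.
Proof.
move=> x /boxP[/andP[ax _] /andP[cx _]].
by split; [exact: lt_le_trans ax|exact: lt_le_trans cx].
Qed.

Let mB : measurable (B : set plane) := measurable_box a b c d.
Let mO := @measurable_Omega R.

Let tame_alg psi : alg psi -> tame B psi.
Proof. by move=> /alg_continuous; exact: tame_continuous. Qed.

Definition barycenter nu (t : R) : R := J (nu t) fst.

Definition transport nu psi (t : R) (x : R * R) : R :=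
  (barycenter nu t + drift x) * D1 psi x.

(* The equation tested against the algebra, with y^p replaced by g y. *)
Definition solves nu : Prop :=
  [/\ forall t, 0 <= t -> nu t (~` B) = 0%E,
      forall psi, alg psi -> {within `[0, +oo[, continuous (fun s : R => J (nu s) psi)} &
      forall psi, alg psi -> forall t : R, 0 < t ->
        is_derive t (1 : R) (fun s : R => J (nu s) psi) (J (nu t) (transport nu psi t))].

Let alg_velocity (m : R) psi : alg psi -> alg (fun x => (m + drift x) * D1 psi x).
Proof.
move=> ap; apply: alg_mul; last exact: alg_D1.
by apply: (@alg_add _ _ (cst m)); [exact: alg_cst|exact: alg_drift].
Qed.

Section one_solution.
Variable nu : R -> @planar_probability R.
Hypothesis snu : solves nu.

Let nuB t : 0 <= t -> nu t (~` B) = 0%E. Proof. by case: snu => h _ _; exact: h. Qed.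

Lemma barycenter_box t : 0 <= t -> a <= barycenter nu t <= b.
Proof.
move=> t0; have ta := tame_cst B a; have tb := tame_cst B b.
have t1 := tame_alg (@alg_fst R); apply/andP; split.
  rewrite -[leLHS](mean_cst mB (nuB t0) mO box_Omega a).
  by apply: (mean_le mB (nuB t0) mO box_Omega ta t1) => x /boxP[/andP[]].
rewrite -[leRHS](mean_cst mB (nuB t0) mO box_Omega b).
by apply: (mean_le mB (nuB t0) mO box_Omega t1 tb) => x /boxP[/andP[]].
Qed.

Lemma mean_mvt psi s t : alg psi -> 0 <= s -> s < t ->
  exists2 r, s < r < t & J (nu t) psi - J (nu s) psi = (t - s) * J (nu r) (transport nu psi r).
Proof.
move=> ap s0 st; have [_ cnu dnu] := snu.
have [|| r rst E] := @MVT _ (fun s => J (nu s) psi) (fun r => J (nu r) (transport nu psi r)) s t st.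
- move=> r; rewrite in_itv/= => /andP[sr _]; apply: dnu => //; exact: le_lt_trans sr.
- apply: continuous_subspaceW (cnu psi ap) => r /=; rewrite !in_itv/= andbT => /andP[sr _].
  exact: le_trans sr.
by exists r; [move: rst; rewrite in_itv|rewrite [RHS]mulrC].
Qed.

Variable V : R.
Hypothesis HV : forall m x, a <= m <= b -> B x -> `|m + drift x| <= V.
Hypothesis V0 : 0 <= V.

Lemma mean_lipschitz psi (C : R) s t : alg psi -> (forall x, B x -> `|D1 psi x| <= C) ->
  0 <= s -> s <= t -> `|J (nu t) psi - J (nu s) psi| <= V * C * (t - s).
Proof.
move=> ap pC s0; rewrite le_eqVlt => /predU1P[->|st].
  by rewrite !subrr normr0 mulr0.
have [r /andP[sr rt] ->] := mean_mvt ap s0 st.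
have r0 : 0 <= r by exact: le_trans (ltW sr).
have ts : 0 < t - s by rewrite subr_gt0.
rewrite normrM gtr0_norm// [leRHS]mulrC ler_pM2l//.
apply: (mean_norm_le mB (nuB r0) mO box_Omega).
  by apply: tame_alg; exact: alg_velocity.
by move=> x Bx; rewrite /transport normrM ler_pM ?HV ?pC//; exact: barycenter_box.
Qed.

Variable W : R.
Hypothesis W0 : 0 <= W.
Hypothesis HW : forall x, B x -> `|D1 drift x| <= W.

Lemma mean_taylor psi s t : alg psi ->
  (forall x, B x -> `|D1 psi x| <= 1) -> (forall x, B x -> `|D1 (D1 psi) x| <= 1) ->
  0 <= s -> s <= t ->
  `|J (nu t) psi - J (nu s) psi - (t - s) * J (nu s) (transport nu psi s)|
    <= (V + V * (W + V)) * (t - s) ^+ 2.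
Proof.
move=> ap p1 p2 s0; rewrite le_eqVlt => /predU1P[->|st].
  by rewrite !subrr mul0r subrr normr0 expr0n mulr0.
have [r /andP[sr rt] ->] := mean_mvt ap s0 st.
have r0 : 0 <= r by exact: le_trans (ltW sr).
have ts : 0 < t - s by rewrite subr_gt0.
have rs : 0 <= r - s by rewrite subr_ge0 ltW.
rewrite -mulrBr normrM gtr0_norm// expr2 mulrCA ler_pM2l//.
pose q x := (barycenter nu s + drift x) * D1 psi x.
have aq : alg q by exact: alg_velocity.
have ar : alg (transport nu psi r) by exact: alg_velocity.
have -> : J (nu r) (transport nu psi r) - J (nu s) (transport nu psi s) =
    (J (nu r) (transport nu psi r) - J (nu r) q) + (J (nu r) q - J (nu s) q).
  by rewrite addrA subrK.
apply: (@le_trans _ _ ((V + V * (W + V)) * (r - s))); last first.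
  by rewrite ler_wpM2l ?lerD2r ?(ltW rt)// addr_ge0// mulr_ge0// addr_ge0.
rewrite mulrDl; apply: le_trans (ler_normD _ _) _; apply: lerD.
  apply: (mean_dist_le mB (nuB r0) mO box_Omega (tame_alg ar) (tame_alg aq)) => x Bx.
  rewrite /transport /q -mulrBl.
  have -> : barycenter nu r + drift x - (barycenter nu s + drift x) = barycenter nu r - barycenter nu s by ring.
  rewrite normrM -[leRHS]mulr1 ler_pM ?p1//.
  rewrite -[V]mulr1; apply: (mean_lipschitz (@alg_fst R)) => // [y _|]; last exact: ltW.
  by rewrite D1_fst normr1.
apply: mean_lipschitz => //; last exact: ltW.
move=> x Bx; rewrite /q D1M; last 2 first.
- by apply: (@alg_add _ _ (cst (barycenter nu s))); [exact: alg_cst|exact: alg_drift].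
- exact: alg_D1.
rewrite addrC (@D1D _ (cst (barycenter nu s)) drift); [|exact: alg_cst|exact: alg_drift].
rewrite D1_cst add0r.
apply: le_trans (ler_normD _ _) _; apply: lerD; rewrite normrM.
  by rewrite -[W]mul1r ler_pM ?p1 ?HW.
by rewrite -[V]mulr1 ler_pM ?p2 ?HV//; exact: barycenter_box.
Qed.

Variable h0 : R.
Hypothesis Hh : forall m h x, a <= m <= b -> 0 <= h <= h0 -> B x -> a <= euler sigma g m h x <= b.

Lemma euler_shear_box m h x : a <= m <= b -> 0 <= h <= h0 -> B x -> B (shear (euler sigma g m h) x).
Proof.
move=> mab hh Bx; apply/boxP; split; first exact: Hh.
by case/boxP : Bx.
Qed.

Lemma alg_euler m h : alg (euler sigma g m h).
Proof.
apply: alg_add; first exact: alg_fst.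
apply: (@alg_mul _ _ (cst h)); first exact: alg_cst.
by apply: (@alg_add _ _ (cst m)); [exact: alg_cst|exact: alg_drift].
Qed.

(** Consistency of the Euler step: [mean_taylor] in time, and [taylor2] in y to replace psi + h
    (velocity) D1 psi by psi after the step. The second replacement adds the V^2 h^2. *)
Lemma mean_euler psi s h : alg psi ->
  (forall x, B x -> `|D1 psi x| <= 1) -> (forall x, B x -> `|D1 (D1 psi) x| <= 1) ->
  0 <= s -> 0 <= h <= h0 ->
  `|J (nu (s + h)) psi - J (nu s) (psi \o shear (euler sigma g (barycenter nu s) h))|
    <= (V + V * (W + V) + V ^+ 2) * h ^+ 2.
Proof.
move=> ap p1 p2 s0 /andP[hge0 hh0].
have := @mean_taylor psi s (s + h) ap p1 p2 s0; rewrite lerDl hge0 => /(_ isT).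
have -> : s + h - s = h by ring.
move=> H.
have cs := barycenter_box s0.
pose q x := psi x + h * transport nu psi s x.
have aq : alg q.
  apply: alg_add => //; apply: (@alg_mul _ _ (cst h)); first exact: alg_cst.
  exact: alg_velocity.
have ae : alg (psi \o shear (euler sigma g (barycenter nu s) h)) by apply: alg_shear => //; exact: alg_euler.
have Jq : J (nu s) q = J (nu s) psi + h * J (nu s) (transport nu psi s).
  have tt : tame B (transport nu psi s) by apply: tame_alg; exact: alg_velocity.
  rewrite (meanD mB (nuB s0) mO box_Omega (tame_alg ap) (tameM (tame_cst B h) tt)).
  by rewrite (meanZ mB (nuB s0) mO box_Omega).
have K : `|J (nu s) q - J (nu s) (psi \o shear (euler sigma g (barycenter nu s) h))| <= V ^+ 2 * h ^+ 2.
  apply: (mean_dist_le mB (nuB s0) mO box_Omega (tame_alg aq) (tame_alg ae)) => x Bx.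
  have [x1 x2] := proj1 (boxP a b c d x) Bx.
  have := @taylor2 R (fun r => psi (r, x.2)) (fun r => D1 psi (r, x.2))
    (fun r => D1 (D1 psi) (r, x.2)) a b 1 _ _ _ x.1 (euler sigma g (barycenter nu s) h x).
  have d1 r : a <= r <= b -> is_derive r (1 : R) (fun r => psi (r, x.2)) (D1 psi (r, x.2)).
    by move=> _; exact: alg_slice.
  have d2 r : a <= r <= b -> is_derive r (1 : R) (fun r => D1 psi (r, x.2)) (D1 (D1 psi) (r, x.2)).
    by move=> _; apply: alg_slice; exact: alg_D1.
  move=> /(_ d1 d2) T2; have := T2 _ x1 _.
  have d3 r : a <= r <= b -> `|D1 (D1 psi) (r, x.2)| <= 1.
    by move=> rab; apply: p2; apply/boxP.
  have hb : a <= euler sigma g (barycenter nu s) h x <= b by apply: Hh => //; rewrite hge0.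
  move=> /(_ d3 hb); rewrite mul1r.
  have -> : euler sigma g (barycenter nu s) h x - x.1 = h * (barycenter nu s + drift x).
    by rewrite /euler; ring.
  rewrite -[X in psi X]/(shear (euler sigma g (barycenter nu s) h) x).
  have -> : (x.1, x.2) = x by case: (x).
  move=> T; rewrite distrC.
  have -> : (psi \o shear (euler sigma g (barycenter nu s) h)) x - q x =
      psi (shear (euler sigma g (barycenter nu s) h) x) - psi x - h * (barycenter nu s + drift x) * D1 psi x.
    by rewrite /q /transport /=; ring.
  apply: (le_trans T); rewrite exprMn mulrC ler_wpM2r ?sqr_ge0//.
  by rewrite -(real_normK (num_real (barycenter nu s + drift x))) lerXn2r ?nnegrE ?HV.
have -> : J (nu (s + h)) psi - J (nu s) (psi \o shear (euler sigma g (barycenter nu s) h)) =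
  (J (nu (s + h)) psi - J (nu s) psi - h * J (nu s) (transport nu psi s)) +
  (J (nu s) q - J (nu s) (psi \o shear (euler sigma g (barycenter nu s) h))).
  by rewrite Jq; ring.
by rewrite mulrDl; apply: le_trans (ler_normD _ _) _; apply: lerD.
Qed.

End one_solution.

Section two_solutions.
Variables nu1 nu2 : R -> @planar_probability R.
Hypotheses (s1 : solves nu1) (s2 : solves nu2).
Hypothesis init : forall psi, alg psi -> J (nu1 0) psi = J (nu2 0) psi.

Let nu1B t : 0 <= t -> nu1 t (~` B) = 0%E. Proof. by case: s1 => h _ _; exact: h. Qed.
Let nu2B t : 0 <= t -> nu2 t (~` B) = 0%E. Proof. by case: s2 => h _ _; exact: h. Qed.

(** Neither psi nor its theta-derivatives are bounded: both solutions have the same initial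
    integrals, and a step moves y only. This admits the unscaled first coordinate and keeps the
    class stable under Euler steps up to a factor. *)
Definition unit_test psi : Prop :=
  [/\ alg psi, forall x, B x -> `|D1 psi x| <= 1 & forall x, B x -> `|D1 (D1 psi) x| <= 1].

Definition close (t D : R) : Prop := forall psi, unit_test psi ->
  `|J (nu1 t) psi - J (nu2 t) psi| <= D.

Lemma unit_test_fst : unit_test fst.
Proof.
split; first exact: alg_fst; move=> x _; first by rewrite D1_fst normr1.
have -> : D1 (fst : R * R -> R) = fun=> 1 by apply/funext => z; exact: D1_fst.
by rewrite D1_cst normr0.
Qed.

Lemma D1Z k psi x : alg psi -> D1 (fun z => k * psi z) x = k * D1 psi x.
Proof.
move=> ap; rewrite (@D1M _ (cst k)) //; last exact: alg_cst.
by rewrite D1_cst mulr0 addr0.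
Qed.

Let aZ k psi : alg psi -> alg (fun z => k * psi z).
Proof. by move=> ap; apply: (@alg_mul _ _ (cst k)) => //; exact: alg_cst. Qed.

Lemma close_scale t D psi C : close t D -> 0 < C -> alg psi ->
  (forall x, B x -> `|D1 psi x| <= C) -> (forall x, B x -> `|D1 (D1 psi) x| <= C) ->
  0 <= t -> `|J (nu1 t) psi - J (nu2 t) psi| <= C * D.
Proof.
move=> cl C0 ap p1 p2 t0.
have E1 : D1 (fun z => C^-1 * psi z) = fun z => C^-1 * D1 psi z.
  by apply/funext => z; exact: D1Z.
have aD := alg_D1 ap.
have ut : unit_test (fun z => C^-1 * psi z).
  split=> [|x Bx|x Bx]; first exact: aZ.
    by rewrite E1 normrM gtr0_norm ?invr_gt0// ler_pdivrMl// mulr1 p1.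
  by rewrite E1 D1Z// normrM gtr0_norm ?invr_gt0// ler_pdivrMl// mulr1 p2.
have := cl _ ut.
rewrite (meanZ mB (nu1B t0) mO box_Omega _ (tame_alg ap)).
rewrite (meanZ mB (nu2B t0) mO box_Omega _ (tame_alg ap)).
by rewrite -mulrBr normrM gtr0_norm ?invr_gt0// ler_pdivrMl.
Qed.

Variables V W W2 h0 : R.
Hypothesis HV : forall m x, a <= m <= b -> B x -> `|m + drift x| <= V.
Hypothesis V0 : 0 <= V.
Hypothesis HW : forall x, B x -> `|D1 drift x| <= W.
Hypothesis W0 : 0 <= W.
Hypothesis HW2 : forall x, B x -> `|D1 (D1 drift) x| <= W2.
Hypothesis W20 : 0 <= W2.
Hypothesis Hh : forall m h x, a <= m <= b -> 0 <= h <= h0 -> B x -> a <= euler sigma g m h x <= b.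
Hypothesis h01 : h0 <= 1.

Let E := 2 * W + W ^+ 2 + W2.
Let K := 2 * (V + V * (W + V) + V ^+ 2).

Let alg_drift1 : alg drift := alg_drift sigma sg.

Lemma D1_euler m h x : D1 (euler sigma g m h) x = 1 + h * D1 drift x.
Proof.
have a1 : alg (fun x => m + drift x).
  by apply: (@alg_add _ _ (cst m)) => //; exact: alg_cst.
rewrite (@D1D _ fst (fun x => h * (m + drift x))); [|exact: alg_fst|exact: aZ].
rewrite D1_fst D1Z// (@D1D _ (cst m)) //; last exact: alg_cst.
by rewrite D1_cst add0r.
Qed.

Lemma D1_shear_euler psi m h : alg psi ->
  D1 (psi \o shear (euler sigma g m h)) =
  fun x => (D1 psi \o shear (euler sigma g m h)) x * (1 + h * D1 drift x).
Proof.
move=> ap; apply/funext => x; rewrite D1_shear ?D1_euler//; exact: alg_euler.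
Qed.

(** The step S has y-derivative at most 1 + hW, so the second derivative of psi o S is at most (1 +
    hW)^2 + h W2; since h <= 1 this is below 1 + h (2W + W^2 + W2), whence [E]. *)
Lemma shear_bounds psi m h : unit_test psi -> a <= m <= b -> 0 <= h <= h0 ->
  [/\ alg (psi \o shear (euler sigma g m h)),
   forall x, B x -> `|D1 (psi \o shear (euler sigma g m h)) x| <= 1 + h * E &
   forall x, B x -> `|D1 (D1 (psi \o shear (euler sigma g m h))) x| <= 1 + h * E].
Proof.
move=> [ap p1 p2] mab hh; have ae := alg_euler m h.
have Bs x : B x -> B (shear (euler sigma g m h) x) by move=> Bx; exact: (euler_shear_box Hh mab hh Bx).
have /andP[hge0 hh0] := hh; have h1 : h <= 1 by exact: le_trans h01.
have hW : 0 <= h * W by rewrite mulr_ge0.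
have bW x : B x -> `|1 + h * D1 drift x| <= 1 + h * W.
  move=> Bx; apply: le_trans (ler_normD _ _) _; rewrite normr1 lerD2l normrM ger0_norm//.
  by rewrite ler_wpM2l// HW.
have WE : h * W <= h * E.
  apply: ler_wpM2l => //; rewrite /E -addrA ler_wpDr ?addr_ge0 ?sqr_ge0//.
  by rewrite -[leLHS]mul1r ler_wpM2r// ler1n.
split; first exact: alg_shear.
  move=> x Bx; rewrite D1_shear_euler// normrM -[leRHS]mul1r.
  by rewrite ler_pM ?p1//; [exact: Bs|apply: le_trans (bW x Bx) _; rewrite lerD2l].
move=> x Bx; rewrite D1_shear_euler//.
have aD := alg_D1 ap; have aDs : alg (D1 psi \o shear (euler sigma g m h)) by exact: alg_shear.
have aDd := alg_D1 alg_drift1.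
have a1 : alg (fun x => 1 + h * D1 drift x).
  by apply: (@alg_add _ _ (cst 1)); [exact: alg_cst|exact: aZ].
rewrite D1M// (D1_shear_euler m h aD) (@D1D _ (cst 1) (fun x => h * D1 drift x)); [|exact: alg_cst|exact: aZ].
rewrite D1_cst add0r D1Z//.
apply: (@le_trans _ _ (h * W2 + (1 + h * W) * (1 * (1 + h * W)))).
  apply: le_trans (ler_normD _ _) _; apply: lerD.
    rewrite normrM -[leRHS]mul1r ler_pM ?p1//; first exact: Bs.
    by rewrite normrM ger0_norm// ler_wpM2l// HW2.
  rewrite normrM ler_pM ?bW// normrM ler_pM ?bW//.
  by rewrite p2//; exact: Bs.
rewrite mul1r /E.
have : h * h * W ^+ 2 <= h * W ^+ 2 by rewrite ler_wpM2r ?sqr_ge0// -[leRHS]mulr1 ler_wpM2l.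
rewrite expr2; lra.
Qed.

(** Three comparisons: each solution with its own Euler step, giving [K]; the two measures on the
    same shifted test function, giving 1 + hE; and the two shifts under the same measure, giving hD,
    because the barycenters are [D]-close. *)
Lemma close_step t h D : 0 <= t -> 0 <= h <= h0 -> close t D ->
  close (t + h) ((1 + h * (E + 1)) * D + K * h ^+ 2).
Proof.
move=> t0 hh cl psi ut; have [ap p1 p2] := ut; have /andP[hge0 hh0] := hh.
have c1 := barycenter_box s1 t0; have c2 := barycenter_box s2 t0.
have T1 := mean_euler s1 HV V0 W0 HW Hh ap p1 p2 t0 hh.
have T2 := mean_euler s2 HV V0 W0 HW Hh ap p1 p2 t0 hh.
have [a1 b1 d1] := shear_bounds ut c1 hh.
have [a2 b2 d2] := shear_bounds ut c2 hh.
have E0 : 0 <= E by rewrite /E addr_ge0// addr_ge0// ?sqr_ge0// mulr_ge0.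
have E1 : 0 < 1 + h * E by rewrite ltr_wpDr// mulr_ge0.
have T3 := close_scale cl E1 a1 b1 d1 t0.
have cc : `|barycenter nu1 t - barycenter nu2 t| <= D by exact: cl unit_test_fst.
have T4 : `|J (nu2 t) (psi \o shear (euler sigma g (barycenter nu1 t) h)) -
    J (nu2 t) (psi \o shear (euler sigma g (barycenter nu2 t) h))| <= h * D.
  apply: (mean_dist_le mB (nu2B t0) mO box_Omega (tame_alg a1) (tame_alg a2)) => x Bx.
  have [x1 x2] := proj1 (boxP a b c d x) Bx.
  have L : forall y z, a <= y <= b -> a <= z <= b -> `|psi (z, x.2) - psi (y, x.2)| <= 1 * `|z - y|.
    apply: (@lipschitz_of_derive _ (fun r => psi (r, x.2)) (fun r => D1 psi (r, x.2))) => r rab.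
      exact: alg_slice.
    by apply: p1; apply/boxP.
  have := L (euler sigma g (barycenter nu2 t) h x) (euler sigma g (barycenter nu1 t) h x) (Hh c2 hh Bx) (Hh c1 hh Bx).
  move/le_trans; apply; rewrite mul1r /euler.
  have -> : x.1 + h * (barycenter nu1 t + drift x) - (x.1 + h * (barycenter nu2 t + drift x)) =
    h * (barycenter nu1 t - barycenter nu2 t) by ring.
  by rewrite normrM ger0_norm// ler_wpM2l.
move: T1 T2 T3 T4.
set A1 := J (nu1 (t + h)) psi; set A2 := J (nu2 (t + h)) psi.
set B1 := J (nu1 t) _; set B2 := J (nu2 t) _; set B3 := J (nu2 t) (_ \o _).
move=> T1 T2 T3 T4.
have -> : A1 - A2 = (A1 - B1) + ((B1 - B3) + ((B3 - B2) - (A2 - B2))) by ring.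
apply: le_trans (ler_normD _ _) _.
apply: le_trans (lerD T1 (le_trans (ler_normD _ _) (lerD T3 (le_trans (ler_normB _ _) (lerD T4 T2))))) _.
by rewrite /K; lra.
Qed.

Lemma close_iter h n : 0 <= h <= h0 ->
  close (h * n%:R) (K * h ^+ 2 * n%:R * (1 + h * (E + 1)) ^+ n).
Proof.
move=> hh; have /andP[hge0 hh0] := hh.
have E0 : 0 <= E by rewrite /E addr_ge0// addr_ge0// ?sqr_ge0// mulr_ge0.
have K0 : 0 <= K by rewrite /K mulr_ge0// addr_ge0 ?sqr_ge0// addr_ge0// mulr_ge0// addr_ge0.
set q := 1 + h * (E + 1).
have q1 : 1 <= q by rewrite lerDl mulr_ge0// addr_ge0.
elim: n => [|n IH].
  by move=> psi [ap _ _]; rewrite !mulr0 mul0r init// subrr normr0.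
move=> psi ut; have -> : h * n.+1%:R = h * n%:R + h by rewrite -natr1 mulrDr mulr1.
have hn0 : 0 <= h * n%:R by rewrite mulr_ge0.
apply: le_trans (close_step hn0 hh IH ut) _.
(* The new error K h^2 is crudely enlarged by the factor q^(n+1) >= 1, which keeps the bound in
   closed form. *)
rewrite -/q -natr1 (exprS q n).
have qn : 1 <= q * q ^+ n by rewrite -exprS exprn_ege1.
have -> : K * h ^+ 2 * (n%:R + 1) * (q * q ^+ n) =
  q * (K * h ^+ 2 * n%:R * q ^+ n) + K * h ^+ 2 * (q * q ^+ n) by ring.
by rewrite lerD2l ler_peMr// mulr_ge0// sqr_ge0.
Qed.

Hypothesis h0_gt0 : 0 < h0.

Lemma close0 t : 0 <= t -> close t 0.
Proof.
move=> t0 psi ut.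
have E0 : 0 <= E by rewrite /E addr_ge0// addr_ge0// ?sqr_ge0// mulr_ge0.
have K0 : 0 <= K by rewrite /K mulr_ge0// addr_ge0 ?sqr_ge0// addr_ge0// mulr_ge0// addr_ge0.
set C := K * t ^+ 2 * expR (t * (E + 1)).
have C0 : 0 <= C by rewrite mulr_ge0 ?expR_ge0// mulr_ge0// sqr_ge0.
apply/ler_addgt0Pr => e e0; rewrite add0r.
(* With n steps of size t/n the accumulated error is at most C/n. This n makes both t/n <= h0 and
   C/n <= e. *)
pose n := (Num.truncn (t / h0 + C / e)).+1.
have nb : t / h0 + C / e < n%:R by rewrite truncnS_gt.
have th0 : 0 <= t / h0 by rewrite divr_ge0// ltW.
have Ce : 0 <= C / e by rewrite divr_ge0// ltW.
have n0 : 0 < n%:R :> R by rewrite ltr0n.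
have hh : 0 <= t / n%:R <= h0.
  rewrite divr_ge0//= ler_pdivrMr// mulrC -ler_pdivrMr//.
  by apply: le_trans (ltW nb); rewrite lerDl.
have := close_iter n hh; rewrite -mulrA mulVf ?mulr1 ?gt_eqF// => /(_ psi ut) /le_trans; apply.
apply: (@le_trans _ _ (C / n%:R)); last first.
  rewrite ler_pdivrMr// mulrC -ler_pdivrMr//.
  by apply: le_trans (ltW nb); rewrite lerDr.
have -> : K * (t / n%:R) ^+ 2 * n%:R = K * t ^+ 2 / n%:R.
  by field; rewrite gt_eqF.
rewrite /C (mulrAC _ (expR _)); apply: ler_wpM2l.
  by rewrite divr_ge0// mulr_ge0// sqr_ge0.
have -> : t * (E + 1) = n%:R * (t / n%:R * (E + 1)) by field; rewrite gt_eqF.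
rewrite expRM_natl lerXn2r ?nnegrE ?expR_ge0 ?expR_ge1Dx//.
by rewrite addr_ge0// mulr_ge0 ?divr_ge0// addr_ge0.
Qed.

End two_solutions.

Lemma solves_unique nu1 nu2 : solves nu1 -> solves nu2 ->
  (forall psi, alg psi -> J (nu1 0) psi = J (nu2 0) psi) ->
  forall t, 0 <= t -> forall psi, alg psi -> J (nu1 t) psi = J (nu2 t) psi.
Proof.
move=> s1 s2 init t t0 psi ap.
have bound f : alg f -> exists2 C : R, 0 <= C & forall x, B x -> `|f x| <= C.
  by move=> /alg_continuous; exact: continuous_bound_box.
have ad := alg_drift sigma sg.
have [V1 V10 HV1] := bound _ ad.
have [W W0 HW] := bound _ (alg_D1 ad).
have [W2 W20 HW2] := bound _ (alg_D1 (alg_D1 ad)).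
have [h0 /andP[h00 h01] Hh] := euler_box sigma0 a0 ab sg ga gb.
have V0 : 0 <= b + V1 by rewrite addr_ge0// ltW// (lt_le_trans a0).
have HV m x : a <= m <= b -> B x -> `|m + drift x| <= b + V1.
  move=> /andP[am mb] Bx; apply: le_trans (ler_normD _ _) _; rewrite lerD ?HV1//.
  by rewrite ger0_norm// (le_trans (ltW a0)).
have cl := close0 s1 s2 init HV V0 HW W0 HW2 W20 Hh h01 h00 t0.
have [C1 C10 H1] := bound _ (alg_D1 ap).
have [C2 C20 H2] := bound _ (alg_D1 (alg_D1 ap)).
apply/eqP; rewrite -subr_eq0 -normr_le0.
have -> : 0 = (C1 + C2 + 1) * 0 :> R by rewrite mulr0.
apply: (close_scale s1 s2 cl) => //.
- by rewrite ltr_wpDl// addr_ge0.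
- by move=> x /H1 /le_trans; apply; rewrite -addrA lerDl addr_ge0.
- by move=> x /H2 /le_trans; apply; rewrite addrAC lerDr addr_ge0.
Qed.

End uniqueness.

(** * Separation of measures *)

Section separation.
Context {R : realType}.
Local Notation plane := (measurableTypeR R * measurableTypeR R)%type.

Definition quadrant (u v : R) : set (R * R) := `]u, +oo[%classic `*` `]v, +oo[%classic.

Definition quadrants : set (set (R * R)) := [set A | exists u v, A = quadrant u v].

Lemma ray_bigcup (u : R) : [set: R] = \bigcup_(k : nat) `]- k%:R, +oo[%classic.
Proof.
apply/seteqP; split=> // x _; exists (Num.truncn `|x|).+1 => //=.
rewrite in_itv/= andbT ltrNl; apply: le_lt_trans (ler_norm _) _; rewrite normrN.
exact: truncnS_gt.
Qed.

(** A half-plane is a countable union of quadrants, so both projections are measurable for the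
    sigma-algebra generated by quadrants. *)
Lemma measurable_quadrants : @measurable _ plane = <<s quadrants >>.
Proof.
apply/seteqP; split=> [A mA|].
  pose T := g_sigma_algebraType quadrants.
  have m1 : measurable_fun [set: T] (fst : T -> measurableTypeR R).
    apply: (measurability _ (RGenOInfty.measurableE R)).
    move=> _ [_ [u ->] <-]; rewrite setTI.
    have -> : fst @^-1` `]u, +oo[%classic = \bigcup_(k : nat) (quadrant u (- k%:R) : set T).
      apply/seteqP; split=> [x /= ux|x [k _ [/= ux _]]//].
      have : [set: R] x.2 by []. 
      by rewrite (ray_bigcup 0) => -[k _ kx]; exists k.
    by apply: bigcupT_measurable => k; apply: sub_sigma_algebra; exists u, (- k%:R).
  have m2 : measurable_fun [set: T] (snd : T -> measurableTypeR R).
    apply: (measurability _ (RGenOInfty.measurableE R)).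
    move=> _ [_ [u ->] <-]; rewrite setTI.
    have -> : snd @^-1` `]u, +oo[%classic = \bigcup_(k : nat) (quadrant (- k%:R) u : set T).
      apply/seteqP; split=> [x /= ux|x [k _ [/= _ ux]]//].
      have : [set: R] x.1 by []. 
      by rewrite (ray_bigcup 0) => -[k _ kx]; exists k.
    by apply: bigcupT_measurable => k; apply: sub_sigma_algebra; exists (- k%:R), u.
  have mid : measurable_fun [set: T] (id : T -> plane).
    by apply/measurable_fun_pairP; split.
  have := mid measurableT A mA; rewrite setTI preimage_id.
  exact.
apply: smallest_sub; first exact: sigma_algebra_measurable.
by move=> _ [u [v ->]]; exact: measurable_rectangle.
Qed.

Lemma quadrant_same_measure (P Q : @planar_probability R) :
  (forall u v, P (quadrant u v) = Q (quadrant u v)) -> same_measure P Q.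
Proof.
move=> PQ A mA.
apply: (@measure_unique _ R plane quadrants (fun k : nat => quadrant (- k%:R) (- k%:R)) _ _ _ _ P Q) => //.
- exact: measurable_quadrants.
- move=> _ _ [u [v ->]] [u' [v' ->]]; exists (Num.max u u'), (Num.max v v').
  apply/seteqP; split=> x; rewrite /quadrant /= !in_itv/= !andbT !gt_max.
    by move=> [[-> ->] [-> ->]].
  by move=> [/andP[-> ->] /andP[-> ->]].
- by move=> i; exists (- i%:R), (- i%:R).
- apply/seteqP; split=> // x _.
  exists (Num.truncn (`|x.1| + `|x.2|)).+1 => //; rewrite /quadrant/= !in_itv/= !andbT.
  have h := truncnS_gt (`|x.1| + `|x.2|).
  have := ler_norm (- x.1); have := ler_norm (- x.2); rewrite !normrN.
  have := normr_ge0 x.1; have := normr_ge0 x.2 => *.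
  by split; lra.
- by move=> _ [u [v ->]]; exact: PQ.
- by move=> k; rewrite (le_lt_trans (probability_le1 _ _)) ?ltry//; exact: measurable_rectangle.
Qed.

(** Because [step] vanishes at 0, the pointwise limit is the indicator of the open quadrant, edges
    excluded. *)
Definition soft_quadrant (u v : R) (n : nat) (x : R * R) : R :=
  step (n%:R * x.1 + - (n%:R * u)) * step (n%:R * x.2 + - (n%:R * v)).

Lemma alg_soft_quadrant u v n : alg (soft_quadrant u v n).
Proof.
have H (l : R * R -> R) w : alg l -> alg (fun x => step (n%:R * l x + w)).
  move=> al; apply: (alg_comp (@smooth1_step R)).
  apply: (@alg_add _ _ _ (cst w)); last exact: alg_cst.
  by apply: (@alg_mul _ _ (cst n%:R)) => //; exact: alg_cst.
by apply: alg_mul; apply: H; [exact: alg_fst|exact: alg_snd].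
Qed.

Lemma step_scaled_cvg (u y : R) :
  step (n%:R * y + - (n%:R * u)) @[n --> \oo] --> ((\1_(`]u, +oo[%classic : set R) y) : R).
Proof.
case: (leP y u) => yu.
  have -> : (\1_(`]u, +oo[%classic : set R) y) = 0 :> R.
    by rewrite indicE memNset//= in_itv/= andbT; apply/negP; rewrite -leNgt.
  apply: cvg_near_cst; apply: nearW => n; apply: step0.
  by rewrite subr_le0 ler_wpM2l.
have -> : (\1_(`]u, +oo[%classic : set R) y) = 1 :> R.
  by rewrite indicE mem_set//= in_itv/= andbT.
apply: cvg_near_cst; near=> n; apply: step1.
rewrite -mulrBr -ler_pdivrMr ?subr_gt0// div1r.
by near: n; exact: nbhs_infty_ger.
Unshelve. all: by end_near. Qed.

Lemma soft_quadrant_cvg u v x :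
  soft_quadrant u v n x @[n --> \oo] --> (\1_(quadrant u v) x : R).
Proof.
have -> : (\1_(quadrant u v) x : R) =
   (\1_(`]u, +oo[%classic : set R) x.1) * (\1_(`]v, +oo[%classic : set R) x.2).
  by rewrite !indicE -natrM mulnb; congr (nat_of_bool _)%:R; apply/idP/andP;
    rewrite !inE.
by apply: cvgM; exact: step_scaled_cvg.
Qed.

Lemma mean_quadrant (P : @planar_probability R) u v :
  (\int[P]_x (soft_quadrant u v n x)%:E)%E @[n --> \oo] --> P (quadrant u v).
Proof.
have mq : measurable (quadrant u v : set plane) by exact: measurable_rectangle.
have E := integral_indic P measurableT mq; rewrite setIT in E.
rewrite -E.
have ms n : measurable_fun setT (fun x : plane => (soft_quadrant u v n x)%:E).
  apply/measurable_EFinP; apply: continuous_measurable2.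
  exact/alg_continuous/alg_soft_quadrant.
have mi : measurable_fun setT (fun x : plane => (\1_(quadrant u v) x : R)%:E).
  apply/(measurable_EFinP _ (fun x : plane => (\1_(quadrant u v) x : R))).
  exact: measurable_indic.
have i1 : P.-integrable setT (cst 1%E : plane -> \bar R).
  by apply: finite_measure_integrable_cst.
have [] // := dominated_convergence measurableT ms mi _ i1.
- apply: aeW => x _; apply: cvg_EFin; first exact: nearW.
  exact: soft_quadrant_cvg.
- apply: aeW => x n _ /=; rewrite lee_fin /soft_quadrant normrM.
  by rewrite !ger0_norm ?step_ge0// mulr_ile1 ?step_ge0 ?step_le1.
Qed.

(** Soft quadrants belong to the algebra and are bounded by 1; dominated convergence gives equality
    on quadrants, a generating family stable under intersection. *)
Lemma alg_separates (P Q : @planar_probability R) (B : set (R * R)) :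
  measurable (B : set plane) -> P (~` B) = 0%E -> Q (~` B) = 0%E -> B `<=` Omega ->
  (forall psi, alg psi -> tame B psi) ->
  (forall psi, alg psi -> \int[P]_(x in Omega) psi x = \int[Q]_(x in Omega) psi x) ->
  same_measure P Q.
Proof.
move=> mB PB QB BO tB PQ; apply: quadrant_same_measure => u v.
have H n : (\int[P]_x (soft_quadrant u v n x)%:E = \int[Q]_x (soft_quadrant u v n x)%:E)%E.
  have aq := alg_soft_quadrant u v n; have tq := tB _ aq.
  have BT : B `<=` setT by [].
  rewrite (tame_integralE mB PB measurableT BT tq) (tame_integralE mB QB measurableT BT tq).
  congr (_%:E).
  rewrite (tame_restrict mB PB measurableT BT tq) (tame_restrict mB QB measurableT BT tq).
  rewrite -(tame_restrict mB PB (@measurable_Omega R) BO tq).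
  by rewrite -(tame_restrict mB QB (@measurable_Omega R) BO tq) PQ.
have c1 := @mean_quadrant P u v; have c2 := @mean_quadrant Q u v.
have E : (fun n => (\int[P]_x (soft_quadrant u v n x)%:E)%E) =
  (fun n => (\int[Q]_x (soft_quadrant u v n x)%:E)%E) by apply/funext.
by rewrite E in c1; exact: cvg_unique c1 c2.
Qed.
End separation.

(** * Cut-offs equal to one around the box *)

Section plateau.
Context {R : realType}.
Variables (a b c d : R).
Hypotheses (a0 : 0 < a) (c0 : 0 < c).
Let B := box a b c d.

(** It is 1 on a neighbourhood of the box, not merely on it, so that multiplying by it leaves
    derivatives at points of the box unchanged. The slopes 4/a and 4/c keep the support at distance
    a/4 and c/4 from the axes. *)
Definition plateau (x : R * R) : R :=
  cutoff (4 / a) (a / 2) (b + 1) x.1 * cutoff (4 / c) (c / 2) (d + 1) x.2.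

Lemma alg_plateau : alg plateau.
Proof.
apply: alg_mul; apply: (alg_comp (smooth1_cutoff _ _ _)).
  exact: alg_fst.
exact: alg_snd.
Qed.

Lemma plateau1 x : a / 2 <= x.1 <= b + 1 -> c / 2 <= x.2 <= d + 1 -> plateau x = 1.
Proof. by move=> h1 h2; rewrite /plateau !cutoff1 ?mulr1// divr_ge0// ltW. Qed.

Lemma plateau_box x : B x -> plateau x = 1.
Proof.
move=> /boxP[/andP[h1 h2] /andP[h3 h4]]; have := a0; have := c0 => c0' a0'.
by apply: plateau1; apply/andP; split; lra.
Qed.

Lemma near_box x : B x -> \forall z \near x, a / 2 <= z.1 <= b + 1 /\ c / 2 <= z.2 <= d + 1.
Proof.
move=> /boxP[/andP[h1 h2] /andP[h3 h4]]; have := a0; have := c0 => c0' a0'.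
have c1 : z.1 @[z --> x] --> x.1 by exact: cvg_fst.
have c2 : z.2 @[z --> x] --> x.2 by exact: cvg_snd.
have o1 : \forall z \near x, a / 2 < z.1 by apply: (cvgr_gt x.1 c1); lra.
have o2 : \forall z \near x, z.1 < b + 1 by apply: (cvgr_lt x.1 c1); lra.
have o3 : \forall z \near x, c / 2 < z.2 by apply: (cvgr_gt x.2 c2); lra.
have o4 : \forall z \near x, z.2 < d + 1 by apply: (cvgr_lt x.2 c2); lra.
near=> z; split; apply/andP; split; apply: ltW; near: z => //.
Unshelve. all: by end_near. Qed.

Definition bigbox : set (R * R) := box (a / 4) (b + 1 + a / 4) (c / 4) (d + 1 + c / 4).

Lemma plateau_support x : plateau x != 0 -> bigbox x.
Proof.
rewrite /plateau mulf_eq0 negb_or => /andP[].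
have ka : 0 < 4 / a by rewrite divr_gt0.
have kc : 0 < 4 / c by rewrite divr_gt0.
move=> /(cutoff_neq0 ka) + /(cutoff_neq0 kc); rewrite !invf_div.
move=> /andP[h1 h2] /andP[h3 h4]; apply/boxP; split; apply/andP; split; lra.
Qed.

Lemma bigbox_Omega : bigbox `<=` Omega.
Proof.
by move=> x /boxP[/andP[h1 _] /andP[h2 _]]; split; [apply: lt_le_trans h1|apply: lt_le_trans h2];
  rewrite divr_gt0.
Qed.

Lemma C0_plateau (f : R * R -> R) : continuous f -> C0_Omega (fun x => plateau x * f x).
Proof.
move=> cf; have cp : continuous (fun x => plateau x * f x).
  by move=> x; apply: cvgM; [exact: alg_continuous alg_plateau x|exact: cf].
split=> // e e0.
have sub : [set x | e <= `|plateau x * f x|] `<=` bigbox.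
  move=> x /= ex; apply: plateau_support; apply: contraTneq ex => ->.
  by rewrite mul0r normr0 -ltNge.
split; last exact: subset_trans bigbox_Omega.
apply: subclosed_compact sub; last exact: compact_box.
have cn : continuous (fun x => `|plateau x * f x|).
  by move=> x; apply: cvg_norm; exact: cp.
by apply: (preimage_closed _ (@closed_ge _ e)) => y _; exact: cn.
Qed.

End plateau.

(** * From measure-valued solutions to the algebra *)

Section bridge.
Context {R : realType}.
Variables (sigma p a b c d : R) (g : R -> R) (mu0 : @planar_probability R).
Variable nu : R -> @planar_probability R.
Hypotheses (a0 : 0 < a) (c0 : 0 < c).
Hypotheses (sg : smooth1 g) (gp : forall y, a <= y <= b -> g y = y `^ p).
Hypothesis gs : global_solution sigma p mu0 nu.
Let B := box a b c d.
Local Notation plane := (measurableTypeR R * measurableTypeR R)%type.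
Hypothesis nuB : forall t, 0 <= t -> nu t (~` B) = 0%E.
Local Notation J P f := (\int[P]_(x in Omega) f x).
Let mB : measurable (B : set plane) := measurable_box a b c d.
Let mO := @measurable_Omega R.
Let BO : B `<=` Omega := box_Omega a0 c0.

Let tame_c (f : R * R -> R) : continuous f -> tame B f.
Proof. exact: tame_continuous. Qed.

(** Weak* continuity speaks of functions vanishing at infinity; multiplying [f] by the plateau makes
    it one without changing its integrals. *)
Lemma mean_continuous (f : R * R -> R) : continuous f ->
  {within `[0, +oo[, continuous (fun s : R => J (nu s) f)}.
Proof.
move=> cf; have Cf := C0_plateau b d a0 c0 cf.
pose F (t : R) : R := J (nu t) (fun x => plateau a b c d x * f x).
have E : {in (`[0, +oo[%classic : set R), F =1 (fun t : R => J (nu t) f)}.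
  move=> t; rewrite inE/= in_itv/= andbT => t0.
  apply: (mean_eq mB (nuB t0) mO BO).
  - by apply: tame_c; case: Cf.
  - exact: tame_c.
  - by move=> x Bx; rewrite (plateau_box a0 c0 Bx) mul1r.
apply: (subspace_eq_continuous E).
apply/subspace_continuousP => s /=; rewrite in_itv/= andbT => s0.
(* Continuity at [s] is local, so the solution property on [0, s + 1) suffices. *)
have T0 : 0 < s + 1 by rewrite ltr_wpDl.
have [_ ws _ _] := gs T0.
have /subspace_continuousP H := ws _ Cf.
have s1 : `[0, s + 1[%classic s by rewrite /= in_itv/= s0 ltrDl ltr01.
have L : F t @[t --> within `[0, s + 1[%classic (nbhs s)] --> F s := H s s1.
have L2 : F t @[t --> within `[0, +oo[%classic (nbhs s)] --> F s.
  apply/cvgrPdist_le => e e0; move/cvgrPdist_le : L => /(_ e e0).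
  rewrite !near_withinE => nA.
  have h : \forall t \near s, t < s + 1 by apply: lt_nbhsl; rewrite ltrDl.
  near=> t; rewrite /= in_itv/= andbT => t0.
  have : `[0, s + 1[%classic t -> `|F s - F t| <= e by near: t; exact: nA.
  by apply; rewrite /= in_itv/= t0/=; near: t; exact: h.
exact: L2.
Unshelve. all: by end_near. Qed.

Lemma pair_continuous (s : R) : continuous (fun x : R * R => (s, x)).
Proof.
move=> x; have H : (s, z) @[z --> x] --> (s, x) by exact: (cvg_pair (cvg_cst s) cvg_id).
exact: H.
Qed.

Lemma slice_continuous (f : R * (R * R) -> R) (s : R) : continuous f -> continuous (fun x => f (s, x)).
Proof.
move=> cf x; have H : {for x, continuous (f \o (fun x => (s, x)))}.
  by apply: continuous_comp; [exact: pair_continuous|exact: cf].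
exact: H.
Qed.

(** The time factor is 1 on [-1, T + 1] and supported in [-2, T + 2], hence admissible for the
    horizon T + 3 and locally constant in time at every point of [0, T], including 0. *)
Definition testfun (psi : R * R -> R) (T : R) (z : R * (R * R)) : R :=
  cutoff 1 (-1) (T + 1) z.1 * (plateau a b c d z.2 * psi z.2).

Lemma alg_testfun psi T : alg psi -> alg (testfun psi T).
Proof.
move=> ap; apply: alg_mul; first exact: (alg_comp (smooth1_cutoff _ _ _) (@alg_time R)).
exact: (alg_space (alg_mul (alg_plateau a b c d) ap)).
Qed.

Lemma test_function_testfun psi T : alg psi -> test_function (T + 3) (testfun psi T).
Proof.
move=> ap; pose L : set (R * (R * R)) := `[-2, T + 2]%classic `*` bigbox a b c d.
have cL : compact L by apply: compact_setX; [exact: segment_compact|exact: compact_box].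
have KL : closure [set z | testfun psi T z != 0] `<=` L.
  have clL : closed L by apply: compact_closed; [exact: norm_hausdorff|exact: cL].
  rewrite ((closure_id L).1 clL).
  apply: closureS => z; rewrite /= /testfun mulf_eq0 negb_or => /andP[zt].
  rewrite mulf_eq0 negb_or => /andP[zp _].
  split; last exact: (plateau_support a0 c0 zp).
  have := cutoff_neq0 ltr01 zt; rewrite invr1 /= in_itv/= => /andP[h1 h2].
  by apply/andP; split; lra.
split.
- exact/alg_smooth/alg_testfun.
- by apply: subclosed_compact KL => //; exact: closed_closure.
- move=> z /KL[]; rewrite /= in_itv/= => /andP[_ h1] /(bigbox_Omega a0 c0) h2.
  by split=> //; lra.
Qed.

Lemma near_testfun psi T (s : R) x : 0 <= s <= T -> B x ->
  \forall z \near ((s, x) : R * (R * R)), psi z.2 = testfun psi T z.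
Proof.
move=> /andP[s0 sT] Bx.
have h1 : \forall u \near s, -1 <= u <= T + 1.
  near=> u; apply/andP; split; apply: ltW; near: u.
    by apply: lt_nbhsr; lra.
  by apply: lt_nbhsl; lra.
have h2 := near_box a0 c0 Bx.
near=> z; rewrite /testfun cutoff1//; last by near: z; exact: cvg_fst h1.
have [k1 k2] : a / 2 <= z.2.1 <= b + 1 /\ c / 2 <= z.2.2 <= d + 1.
  by near: z; exact: (cvg_snd h2).
by rewrite (plateau1 a0 c0 k1 k2) !mul1r.
Unshelve. all: by end_near. Qed.

Lemma testfun_box psi T (s : R) x : 0 <= s <= T -> B x -> testfun psi T (s, x) = psi x.
Proof. by move=> sT Bx; have := near_testfun psi sT Bx => /nbhs_singleton ->. Qed.

Lemma dt_testfun psi T (s : R) x : 0 <= s <= T -> B x -> dt (testfun psi T) (s, x) = 0.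
Proof.
move=> sT Bx; have := near_testfun psi sT Bx => h.
rewrite /dt -(near_eq_derive _ h).
have H : is_derive ((s, x) : R * (R * R)) ((1, (0, 0)) : R * (R * R)) (fun z => psi z.2) 0.
  apply/is_derive_line.
  rewrite (_ : (fun h : R => _) = cst (psi x)); first exact: is_derive_cst.
  apply/funext => k /=; congr psi.
  have -> : k *: ((0, 0) : R * R) = 0 by exact: scaler0.
  by rewrite add0r.
exact: (@derive_val _ _ _ _ _ _ _ H).
Qed.

Lemma dy_testfun psi T (s : R) x : alg psi -> 0 <= s <= T -> B x ->
  dy (testfun psi T) (s, x) = D1 psi x.
Proof.
move=> ap sT Bx; have := near_testfun psi sT Bx => h.
rewrite /dy -(near_eq_derive _ h).
have H : is_derive ((s, x) : R * (R * R)) ((0, (1, 0)) : R * (R * R)) (fun z => psi z.2) (D1 psi x).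
  apply/is_derive_line.
  have /is_derive_line H := alg_is_deriveE x ((1, 0) : R * R) ap.
  exact: H.
exact: (@derive_val _ _ _ _ _ _ _ H).
Qed.

Let G psi (s : R) : R := J (nu s) (transport sigma g nu psi s).

Lemma velocityE (s : R) x : 0 <= s ->
  velocity sigma p (nu s) x = barycenter nu s - x.1 + sigma * (x.2 - x.1 `^ p) * x.1.
Proof.
move=> s0; rewrite /velocity; congr (_ + _).
have tf : tame B fst by apply: tame_c => y; exact: cvg_fst.
by rewrite (meanB mB (nuB s0) mO BO tf (tame_cst B x.1)) (mean_cst mB (nuB s0) mO BO).
Qed.

Lemma weak_form_rhs psi T (s : R) : alg psi -> 0 <= s <= T ->
  (\int[nu s]_(x in Omega) (dt (testfun psi T) (s, x) +
      velocity sigma p (nu s) x * dy (testfun psi T) (s, x))%:E = (G psi s)%:E)%E.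
Proof.
move=> ap sT; have /andP[s0 _] := sT.
have at1 := alg_testfun T ap.
have ta : tame B (fun x => dt (testfun psi T) (s, x)).
  by apply/tame_c/slice_continuous/alg_continuous; exact: alg_derive.
have tb : tame B (fun x => dy (testfun psi T) (s, x)).
  by apply/tame_c/slice_continuous/alg_continuous; exact: alg_derive.
have tr : tame B (transport sigma g nu psi s).
  apply/tame_c/alg_continuous/alg_mul; last exact: alg_D1.
  by apply: (@alg_add _ _ (cst (barycenter nu s))); [exact: alg_cst|exact: alg_drift].
have E x : B x -> dt (testfun psi T) (s, x) +
      velocity sigma p (nu s) x * dy (testfun psi T) (s, x) = transport sigma g nu psi s x.
  move=> Bx; rewrite dt_testfun// dy_testfun// add0r velocityE// /transport /drift.
  have [x1 _] := proj1 (boxP a b c d x) Bx.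
  by rewrite gp//; congr (_ * _); ring.
have tl : tame B (fun x => dt (testfun psi T) (s, x) +
      velocity sigma p (nu s) x * dy (testfun psi T) (s, x)).
  (* The integrand contains a power of y, so its measurability is assembled by hand; on the box it
     coincides with the continuous transport term, which bounds it. *)
  split; last by have [_ [C hC]] := tr; exists C => x Bx; rewrite E// hC.
  have [mta _] := ta; have [mtb _] := tb.
  have m1 : measurable_fun [set: plane] (fst : plane -> R) by exact: measurable_fst.
  have m2 : measurable_fun [set: plane] (snd : plane -> R) by exact: measurable_snd.
  have mp : measurable_fun [set: plane] ((@powR R ^~ p) \o (fst : plane -> measurableTypeR R)).
    exact (measurableT_comp (@measurable_powR R p) (@measurable_fst _ _ (measurableTypeR R) (measurableTypeR R))).
  have mv : measurable_fun [set: plane] (fun x : plane => velocity sigma p (nu s) x).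
    rewrite (_ : (fun x : plane => _) = (fun x : plane => barycenter nu s - x.1 +
        sigma * (x.2 - (x.1 : R) `^ p) * x.1)); last by apply/funext => x; exact: velocityE.
    have mc k : measurable_fun [set: plane] (fun _ : plane => k : R) by exact: measurable_cst.
    exact: (measurable_funD (measurable_funB (mc _) m1)
      (measurable_funM (measurable_funM (mc _) (measurable_funB m2 mp)) m1)).
  exact: (measurable_funD mta (measurable_funM mv mtb)).
rewrite (tame_integralE mB (nuB s0) mO BO tl) /G; congr (_%:E).
by apply: (mean_eq mB (nuB s0) mO BO).
Qed.

(** The barycenter factors out of the integral, leaving sums and products of integrals of fixed
    continuous functions. *)
Lemma continuous_G psi : alg psi -> {within `[0, +oo[, continuous (G psi)}.
Proof.
move=> ap; have c1 := mean_continuous (alg_continuous (@alg_fst R)).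
have aD := alg_D1 ap; have ad := alg_drift sigma sg.
have am := alg_mul ad aD.
have c2 := mean_continuous (alg_continuous aD).
have c3 := mean_continuous (alg_continuous am).
pose F (t : R) : R := barycenter nu t * J (nu t) (D1 psi) + J (nu t) (fun x => drift sigma g x * D1 psi x).
have E : {in (`[0, +oo[%classic : set R), F =1 G psi}.
  move=> t; rewrite inE/= in_itv/= andbT => t0; rewrite /F /G /transport.
  have tD := tame_c (alg_continuous aD); have tm := tame_c (alg_continuous am).
  rewrite -(meanZ mB (nuB t0) mO BO _ tD).
  rewrite -(meanD mB (nuB t0) mO BO (tameM (tame_cst B (barycenter nu t)) tD) tm).
  by apply: eq_Rintegral => x _; apply/esym/mulrDl.
apply: (subspace_eq_continuous E) => s.
by apply: cvgD; [apply: cvgM; [exact: c1|exact: c2]|exact: c3].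
Qed.

Lemma weak_form psi (t : R) : alg psi -> 0 < t ->
  J (nu t) psi = J (nu 0) psi + \int[@lebesgue_measure R]_(s in `[0, t]) G psi s.
Proof.
move=> ap t0.
have T3 : 0 < t + 1 + 3 by rewrite !addr_gt0.
have [_ _ same weak] := gs T3.
have := weak _ (test_function_testfun (t + 1) ap) t.
have tT : 0 < t < t + 1 + 3 by rewrite t0/= -addrA ltrDl addr_gt0.
move=> /(_ tT).
have st (s : R) : 0 <= s <= t -> 0 <= s <= t + 1.
  by move=> /andP[-> st]/=; rewrite (le_trans st)// lerDl.
have cs (s : R) : continuous (fun x => testfun psi (t + 1) (s, x)).
  exact/slice_continuous/alg_continuous/alg_testfun.
have tp := tame_c (alg_continuous ap).
have L (s : R) : 0 <= s <= t ->
    (\int[nu s]_(x in Omega) (testfun psi (t + 1) (s, x))%:E = (J (nu s) psi)%:E)%E.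
  move=> sT; have /andP[s0 _] := sT.
  rewrite (tame_integralE mB (nuB s0) mO BO (tame_c (cs s))); congr (_%:E).
  apply: (mean_eq mB (nuB s0) mO BO) => //; first exact: tame_c.
  by move=> x Bx; rewrite testfun_box// st.
rewrite L ?lexx ?ltW//.
have -> : (\int[mu0]_(x in Omega) (testfun psi (t + 1) (0, x))%:E = (J (nu 0) psi)%:E)%E.
  rewrite -L ?lexx ?ltW//; apply: eq_measure_integral => A mA _.
  by apply/esym; exact: same.
have -> : (\int[@lebesgue_measure R]_(s in `[0%R, t])
    \int[nu s]_(x in Omega) (dt (testfun psi (t + 1)) (s, x) +
      velocity sigma p (nu s) x * dy (testfun psi (t + 1)) (s, x))%:E =
   \int[@lebesgue_measure R]_(s in `[0%R, t]) (G psi s)%:E)%E.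
  apply: eq_integral => s; rewrite inE/= in_itv/= => sT.
  by rewrite weak_form_rhs// st.
have iG : (@lebesgue_measure R).-integrable `[0, t] (EFin \o G psi).
  apply: continuous_compact_integrable; first exact: segment_compact.
  apply: continuous_subspaceW (continuous_G ap) => s /=.
  by rewrite !in_itv/= andbT => /andP[].
move=> /(congr1 fine) /= ->.
by rewrite fineD// integrable_fin_num.
Qed.

(** Continuity of [G] upgrades the integral identity to a derivative at every positive time, by the
    fundamental theorem on [0, t + 1]. *)
Lemma solution_solves : solves sigma a b c d g nu.
Proof.
split=> [//|psi ap|psi ap t t0]; first exact/mean_continuous/alg_continuous.
have iG : (@lebesgue_measure R).-integrable `[0, t + 1] (EFin \o G psi).
  apply: continuous_compact_integrable; first exact: segment_compact.
  apply: continuous_subspaceW (continuous_G ap) => s /=.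
  by rewrite !in_itv/= andbT => /andP[].
have cG : {for t, continuous (G psi)}.
  have t1 : 0 < t + 1 by rewrite addr_gt0.
  apply: (within_continuous_continuous t1); last by rewrite in_itv/= t0 ltrDl ltr01.
  apply: continuous_subspaceW (continuous_G ap) => s /=.
  by rewrite !in_itv/= andbT => /andP[].
have tt : t < t + 1 by rewrite ltrDl.
have [D E] := continuous_FTC1_closed tt iG t0 cG.
have H : is_derive t (1 : R) (fun s => \int[@lebesgue_measure R]_(r in `[0, s]) G psi r) (G psi t).
  by rewrite -E derive1E; exact/derivableP.
have H2 := is_deriveD (is_derive_cst (J (nu 0) psi) t (1 : R)) H.
rewrite -[X in is_derive _ _ _ X]add0r; apply: near_eq_is_derive H2.
near=> s; have s0 : 0 < s by near: s; exact: lt_nbhsr.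
by rewrite (weak_form ap s0).
Unshelve. all: by end_near. Qed.

End bridge.

(** * Convergence of the Euler scheme *)

Section euler_scheme.
Context {R : realType} (X : Type).
Variables (good : set (X -> R)) (V : (X -> R) -> X -> R) (Y0 : X -> R) (h0 L M : R).
Hypotheses (h0_gt0 : 0 < h0) (L0 : 0 <= L) (M0 : 0 <= M).
Hypothesis good0 : good Y0.
Hypothesis good_step : forall Y (h : R), good Y -> 0 <= h <= h0 ->
  good (fun x => Y x + h * V Y x).
Hypothesis V_bound : forall Y x, good Y -> `|V Y x| <= M.
Hypothesis V_lip : forall Y Z (e : R), good Y -> good Z ->
  (forall x, `|Y x - Z x| <= e) -> forall x, `|V Y x - V Z x| <= L * e.
Hypothesis good_lim : forall (u : nat -> X -> R) l, (forall n, good (u n)) ->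
  (forall x, u n x @[n --> \oo] --> l x) -> good l.

(** A step updates the function [Y] as a whole, since [V] may depend on all its values; [good] is
    the invariant class on which [V] is controlled. *)
Definition estep (h : R) (Y : X -> R) : X -> R := fun x => Y x + h * V Y x.
Definition mesh (n : nat) : R := h0 / 2 ^+ n.
Definition eiter (n k : nat) : X -> R := iter k (estep (mesh n)) Y0.

Lemma mesh_gt0 n : 0 < mesh n.
Proof. by rewrite divr_gt0// exprn_gt0. Qed.

Lemma mesh_le n : mesh n <= h0.
Proof. by rewrite ler_pdivrMr ?exprn_gt0// ler_peMr ?exprn_ege1 ?ler1n// ltW. Qed.

Lemma meshS n : mesh n = 2 * mesh n.+1.
Proof. by rewrite /mesh exprS; field; rewrite expf_neq0. Qed.

Lemma good_eiter n k : good (eiter n k).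
Proof.
elim: k => [//|k IH]; rewrite /eiter iterS; apply: good_step => //.
by rewrite mesh_le ltW ?mesh_gt0.
Qed.

Lemma eiterS n k x : eiter n k.+1 x = eiter n k x + mesh n * V (eiter n k) x.
Proof. by []. Qed.

Lemma eiter_lip n k j x : `|eiter n (k + j) x - eiter n k x| <= M * (j%:R * mesh n).
Proof.
have h := ltW (mesh_gt0 n).
elim: j => [|j IH]; first by rewrite addn0 subrr normr0 !mul0r mulr0.
rewrite addnS eiterS addrAC; apply: le_trans (ler_normD _ _) _.
rewrite -natr1 mulrDl mul1r mulrDr; apply: lerD => //.
by rewrite normrM ger0_norm// mulrC ler_wpM2r// V_bound//; exact: good_eiter.
Qed.

(** After j steps the field has changed by at most L M j h; summing h L M j h stays below L M (j
    h)^2. Uniformity in the mesh is what lets the estimate pass to the limit. *)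
Lemma eiter_taylor n k j x :
  `|eiter n (k + j) x - eiter n k x - j%:R * mesh n * V (eiter n k) x|
    <= L * M * (j%:R * mesh n) ^+ 2.
Proof.
have h := ltW (mesh_gt0 n).
elim: j => [|j IH]; first by rewrite addn0 subrr !mul0r subrr normr0 expr0n !mulr0.
rewrite addnS eiterS -natr1.
have -> : eiter n (k + j) x + mesh n * V (eiter n (k + j)) x - eiter n k x
    - (j%:R + 1) * mesh n * V (eiter n k) x =
  (eiter n (k + j) x - eiter n k x - j%:R * mesh n * V (eiter n k) x) +
  mesh n * (V (eiter n (k + j)) x - V (eiter n k) x) by ring.
apply: le_trans (ler_normD _ _) _.
have H : `|mesh n * (V (eiter n (k + j)) x - V (eiter n k) x)| <= mesh n * (L * (M * (j%:R * mesh n))).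
  rewrite normrM ger0_norm// ler_wpM2l//.
  by apply: V_lip; [exact: good_eiter|exact: good_eiter|move=> y; exact: eiter_lip].
apply: le_trans (lerD IH H) _.
have -> : L * M * ((j%:R + 1) * mesh n) ^+ 2 = L * M * (j%:R * mesh n) ^+ 2 +
   mesh n * (L * (M * (j%:R * mesh n))) + (L * M * mesh n ^+ 2 * (j%:R + 1)) by ring.
rewrite lerDl; apply: mulr_ge0; last by rewrite addr_ge0.
by apply: mulr_ge0; [exact: mulr_ge0|exact: sqr_ge0].
Qed.

(** Two half steps differ from one full step by at most L M h^2, and an earlier discrepancy is
    amplified by 1 + hL. *)
Lemma eiter_refine n k x :
  `|eiter n.+1 (2 * k) x - eiter n k x| <= L * M * mesh n ^+ 2 * k%:R * (1 + mesh n * L) ^+ k.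
Proof.
have h := ltW (mesh_gt0 n); have h' := ltW (mesh_gt0 n.+1).
have q1 : 1 <= 1 + mesh n * L by rewrite lerDl mulr_ge0.
elim: k x => [|k IH] x; first by rewrite muln0 subrr normr0 mulr0 mul0r.
pose e := L * M * mesh n ^+ 2 * k%:R * (1 + mesh n * L) ^+ k; rewrite -/e in IH.
rewrite mulnS add2n !eiterS -[k.+1%:R]natr1 (exprS (1 + mesh n * L)).
set A := eiter n.+1 (2 * k) in IH *; set A1 := eiter n.+1 (2 * k).+1; set C := eiter n k in IH *.
have gA : good A by exact: good_eiter.
have gA1 : good A1 by exact: good_eiter.
have gC : good C by exact: good_eiter.
have v1 : `|V A x - V C x| <= L * e by exact: V_lip.
have v2 : `|V A1 x - V A x| <= L * (M * mesh n.+1).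
  apply: V_lip => // y; have := eiter_lip n.+1 (2 * k) 1 y.
  by rewrite addn1 mul1r.
have -> : A x + mesh n.+1 * V A x + mesh n.+1 * V A1 x - (C x + mesh n * V C x) =
   (A x - C x) + (mesh n * (V A x - V C x) + mesh n.+1 * (V A1 x - V A x)).
  by rewrite (meshS n); ring.
have -> : L * M * mesh n ^+ 2 * (k%:R + 1) * ((1 + mesh n * L) * (1 + mesh n * L) ^+ k) =
  (1 + mesh n * L) * e + L * M * mesh n ^+ 2 * ((1 + mesh n * L) * (1 + mesh n * L) ^+ k).
  by rewrite /e; ring.
apply: le_trans (ler_normD _ _) _.
have w1 : `|mesh n * (V A x - V C x)| <= mesh n * (L * e) by rewrite normrM ger0_norm// ler_wpM2l.
have w2 : `|mesh n.+1 * (V A1 x - V A x)| <= mesh n.+1 * (L * (M * mesh n.+1)).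
  by rewrite normrM ger0_norm// ler_wpM2l.
apply: le_trans (lerD (IH x) (le_trans (ler_normD _ _) (lerD w1 w2))) _.
have -> : (1 + mesh n * L) * e = e + mesh n * (L * e) by ring.
rewrite -addrA lerD2l lerD2l.
have qk : 1 <= (1 + mesh n * L) * (1 + mesh n * L) ^+ k by rewrite -exprS exprn_ege1.
apply: (@le_trans _ _ (L * M * mesh n ^+ 2)).
  have -> : mesh n.+1 * (L * (M * mesh n.+1)) = L * M * mesh n.+1 ^+ 2 by ring.
  rewrite ler_wpM2l// ?mulr_ge0// lerXn2r// ?nnegrE// (meshS n).
  by rewrite ler_peMl// ler1n.
by rewrite ler_peMr// mulr_ge0 ?sqr_ge0// mulr_ge0.
Qed.

Definition eindex (n : nat) (t : R) : nat := Num.truncn (t / mesh n).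

Lemma eindex_itv n t : 0 <= t ->
  (eindex n t)%:R * mesh n <= t /\ t < (eindex n t)%:R * mesh n + mesh n.
Proof.
move=> t0; have h := mesh_gt0 n.
have /andP[] := @truncn_itv _ (t / mesh n) (divr_ge0 t0 (ltW h)).
by rewrite ler_pdivlMr// ltr_pdivrMr// -natr1 mulrDl mul1r.
Qed.

(** Halving the mesh doubles the number of completed steps, up to one extra fine step. *)
Lemma eindexS n t : 0 <= t ->
  eindex n.+1 t = (2 * eindex n t)%N \/ eindex n.+1 t = (2 * eindex n t).+1.
Proof.
move=> t0; have [h1 h2] := eindex_itv n t0; have [h3 h4] := eindex_itv n.+1 t0.
have h := mesh_gt0 n.+1; rewrite meshS in h1 h2.
have e1 (k : nat) : k.+1%:R * mesh n.+1 = k%:R * mesh n.+1 + mesh n.+1.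
  by rewrite -[k.+1%:R]natr1 mulrDl mul1r.
have e2 : (2 * eindex n t)%:R * mesh n.+1 = (eindex n t)%:R * (2 * mesh n.+1).
  by rewrite natrM; ring.
have l1 : (2 * eindex n t)%:R < (eindex n.+1 t).+1%:R :> R.
  by rewrite -(ltr_pM2r h) e1 e2; exact: le_lt_trans h1 h4.
have l2 : (eindex n.+1 t)%:R < ((2 * eindex n t).+2)%:R :> R.
  rewrite -(ltr_pM2r h) !e1 e2; apply: le_lt_trans h3 _.
  by apply: lt_le_trans h2 _; rewrite -addrA lerD2l mulr_natl mulr2n.
move: l1 l2; rewrite !ltr_nat ltnS !ltnS => l1; rewrite leq_eqVlt => /orP[/eqP ->|]; first by right.
by rewrite ltnS => l2; left; apply/eqP; rewrite eqn_leq l1 l2.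
Qed.

Definition approx (n : nat) (t : R) : X -> R := eiter n (eindex n t).

Let rate (t : R) : R := L * M * t * expR (t * L) + M.

Let rate_ge0 t : 0 <= t -> 0 <= rate t.
Proof. by move=> t0; rewrite addr_ge0// !mulr_ge0// expR_ge0. Qed.

(** In [rate], the exponential part comes from [eiter_refine] with k h <= t, and the final [M] from
    the possible extra fine step. *)
Lemma approx_cauchy n t x : 0 <= t -> `|approx n.+1 t x - approx n t x| <= rate t * mesh n.
Proof.
move=> t0; have [h1 h2] := eindex_itv n t0; have h := ltW (mesh_gt0 n).
set k := eindex n t in h1 h2 *.
have a1 : `|eiter n.+1 (2 * k) x - eiter n k x| <= L * M * t * expR (t * L) * mesh n.
  apply: le_trans (eiter_refine n k x) _.
  have e1 : (1 + mesh n * L) ^+ k <= expR (t * L).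
    apply: (@le_trans _ _ (expR (k%:R * (mesh n * L)))).
      rewrite expRM_natl lerXn2r ?nnegrE ?expR_ge0 ?expR_ge1Dx//.
      by rewrite addr_ge0// mulr_ge0.
    by rewrite ler_expR mulrA ler_wpM2r.
  have -> : L * M * mesh n ^+ 2 * k%:R * (1 + mesh n * L) ^+ k =
    (L * M * mesh n) * ((k%:R * mesh n) * (1 + mesh n * L) ^+ k) by ring.
  have -> : L * M * t * expR (t * L) * mesh n = (L * M * mesh n) * (t * expR (t * L)) by ring.
  apply: ler_wpM2l; first by rewrite mulr_ge0// mulr_ge0.
  apply: ler_pM => //; first by rewrite mulr_ge0.
  by rewrite exprn_ge0// addr_ge0// mulr_ge0.
have a2 : `|approx n.+1 t x - eiter n.+1 (2 * k) x| <= M * mesh n.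
  rewrite /approx; have [->|->] := eindexS n t0.
    by rewrite subrr normr0 mulr_ge0.
  have := eiter_lip n.+1 (2 * k) 1 x; rewrite addn1 mul1r => /le_trans; apply.
  by rewrite ler_wpM2l// (meshS n) ler_peMl ?ler1n// ltW// mesh_gt0.
have -> : approx n.+1 t x - approx n t x =
  (eiter n.+1 (2 * k) x - eiter n k x) + (approx n.+1 t x - eiter n.+1 (2 * k) x).
  by rewrite /approx -/k; ring.
by apply: le_trans (ler_normD _ _) _; rewrite mulrDl; apply: lerD.
Qed.

(** The intervals u_n +- 2 C mesh n are nested, because 2 C mesh n - 2 C mesh (n+1) = C mesh n; the
    supremum of the left ends is the limit, with its rate. *)
Lemma geometric_limit (u : nat -> R) (C : R) : (forall n, `|u n.+1 - u n| <= C * mesh n) ->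
  exists l, forall n, `|l - u n| <= 2 * C * mesh n.
Proof.
move=> uC; have C0 : 0 <= C * mesh 0 by exact: le_trans (uC 0).
have {}C0 : 0 <= C by move: C0; rewrite pmulr_lge0// mesh_gt0.
pose w n := u n - 2 * C * mesh n; pose v n := u n + 2 * C * mesh n.
have wS n : w n <= w n.+1.
  by have := uC n; rewrite /w (meshS n) ler_norml => /andP[h _]; lra.
have vS n : v n.+1 <= v n.
  by have := uC n; rewrite /v (meshS n) ler_norml => /andP[_ h]; lra.
have wm : {homo w : m n / (m <= n)%N >-> m <= n} by apply: (homo_leq (r := fun x y => x <= y)) => // y x z; exact: le_trans.
have vm : {homo v : m n / (m <= n)%N >-> n <= m}.
  by apply: (homo_leq (r := fun x y => y <= x)) => // y x z xy yz; exact: le_trans yz xy.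
have wv n : w n <= v n.
  by rewrite /w /v lerD2l ge0_cp// mulr_ge0// ?mulr_ge0// ltW// mesh_gt0.
have wv2 m n : w m <= v n.
  have [mn|/ltnW nm] := leqP m n; first exact: le_trans (wm _ _ mn) (wv n).
  exact: le_trans (wv m) (vm _ _ nm).
have hs : has_sup (range w).
  by split; [exists (w 0%N), 0%N|exists (v 0%N) => _ [m _ <-]].
exists (sup (range w)) => n.
have l1 : w n <= sup (range w) by apply: ub_le_sup; [case: hs|exists n].
have l2 : sup (range w) <= v n by apply: ge_sup; [case: hs|move=> _ [m _ <-]].
by rewrite ler_norml; move: l1 l2; rewrite /w /v => l1 l2; apply/andP; split; lra.
Qed.

Lemma mesh_small (e : R) : 0 < e -> exists n, mesh n <= e.
Proof.
move=> e0; exists (Num.truncn (h0 / e)).+1; set n := _.+1.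
rewrite ler_pdivrMr ?exprn_gt0// -ler_pdivrMl// mulrC.
apply: (@le_trans _ _ n%:R); first exact/ltW/truncnS_gt.
by rewrite -natrX ler_nat ltnW// ltn_expl.
Qed.

Lemma mesh_cvg0 : mesh n @[n --> \oo] --> 0.
Proof.
apply/cvgrPdist_le => e e0; have [n ne] := mesh_small e0.
exists n => // m /= nm; rewrite sub0r normrN gtr0_norm ?mesh_gt0//.
apply: le_trans ne; rewrite ler_pM2l// lef_pV2 ?posrE ?exprn_gt0//.
by rewrite ler_weXn2l// ler1n.
Qed.

Lemma euler_limit : exists Y : R -> X -> R,
  [/\ forall x, Y 0 x = Y0 x,
      forall t, 0 <= t -> good (Y t),
      forall s t x, 0 <= s -> s <= t -> `|Y t x - Y s x| <= M * (t - s) &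
      forall s t x, 0 <= s -> s <= t ->
        `|Y t x - Y s x - (t - s) * V (Y s) x| <= L * M * (t - s) ^+ 2].
Proof.
have ex (t : R) (x : X) : exists l, 0 <= t -> forall n, `|l - approx n t x| <= 2 * rate t * mesh n.
  have [t0|t0] := leP 0 t; last by exists 0.
  have [l hl] := geometric_limit (fun n => approx_cauchy n x t0).
  by exists l.
pose Y t x := projT1 (cid (ex t x)).
have YE t x n : 0 <= t -> `|Y t x - approx n t x| <= 2 * rate t * mesh n.
  by move=> t0; exact: (projT2 (cid (ex t x)) t0).
have gY t : 0 <= t -> good (Y t).
  move=> t0; apply: (good_lim (u := fun n => approx n t)) => [n|x]; first exact: good_eiter.
  apply/cvgrPdist_le => e e0.
  have C1 : 0 < 2 * rate t + 1 by rewrite ltr_wpDl// mulr_ge0// rate_ge0.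
  have ec : 0 < e / (2 * rate t + 1) by rewrite divr_gt0.
  have /cvgrPdist_le/(_ _ ec) := mesh_cvg0.
  apply: filterS => n; rewrite sub0r normrN gtr0_norm ?mesh_gt0// ler_pdivlMr// => h.
  apply: le_trans (YE t x n t0) _; apply: le_trans h.
  by rewrite mulrC ler_wpM2l ?lerDl// ltW// mesh_gt0.
have small (A B C : R) : (forall n, A <= B + C * mesh n) -> A <= B.
  move=> H; apply/ler_addgt0Pr => e e0.
  have ec : 0 < e / (`|C| + 1) by rewrite divr_gt0// ltr_wpDl.
  have [n] := mesh_small ec; rewrite ler_pdivlMr ?ltr_wpDl// => ne.
  apply: le_trans (H n) _; rewrite lerD2l; apply: le_trans ne.
  rewrite mulrC ler_wpM2l//; first exact/ltW/mesh_gt0.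
  by apply: le_trans (ler_norm _) _; rewrite lerDl.
(* Times s and t are compared through the number j of steps between their grid points; j times the
   mesh misses t - s by at most one mesh. *)
have split_index s t n : 0 <= s -> s <= t -> exists j, 
    [/\ approx n t = eiter n (eindex n s + j), j%:R * mesh n <= t - s + mesh n &
        t - s <= j%:R * mesh n + mesh n].
  move=> s0 st; have t0 : 0 <= t by exact: le_trans st.
  have [s1 s2] := eindex_itv n s0; have [t1 t2] := eindex_itv n t0.
  have h := mesh_gt0 n.
  have le : (eindex n s <= eindex n t)%N.
    rewrite -ltnS -(ltr_nat R) -(ltr_pM2r h) -natr1 mulrDl mul1r.
    by apply: le_lt_trans t2; exact: le_trans st.
  exists (eindex n t - eindex n s)%N; rewrite subnKC// natrB// mulrBl; split => //; lra.
exists Y; split=> //.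
- move=> x; apply/eqP; rewrite -subr_eq0 -normr_le0.
  apply: (@small _ _ (2 * rate 0)) => n; rewrite add0r.
  have := YE 0 x n (lexx _); rewrite /approx.
  by have -> : eindex n 0 = 0%N by rewrite /eindex mul0r truncn0.
- move=> s t x s0 st; have t0 : 0 <= t by exact: le_trans st.
  apply: (@small _ _ (2 * rate t + 2 * rate s + M)) => n.
  have [j [E j1 j2]] := split_index s t n s0 st.
  have -> : Y t x - Y s x = (Y t x - approx n t x) - (Y s x - approx n s x) +
    (approx n t x - approx n s x) by ring.
  have y1 := YE t x n t0; have y2 := YE s x n s0.
  have y3 : `|approx n t x - approx n s x| <= M * (t - s + mesh n).
    by rewrite E; apply: le_trans (eiter_lip _ _ _ _) _; rewrite ler_wpM2l.
  apply: le_trans (ler_normD _ _) _.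
  apply: le_trans (lerD (le_trans (ler_normB _ _) (lerD y1 y2)) y3) _.
  by rewrite le_eqVlt; apply/orP; left; apply/eqP; ring.
- move=> s t x s0 st; have t0 : 0 <= t by exact: le_trans st.
  have ts : 0 <= t - s by rewrite subr_ge0.
  have rs := rate_ge0 s0; have rt := rate_ge0 t0.
  (* The factor of the mesh collects the distances of [Y] to the approximations at t and s, the
     error of replacing j h by t - s in the quadratic and in the linear term, and the change of [V]
     from [approx n s] to [Y s]. *)
  apply: (@small _ _ (2 * rate t + 2 * rate s + L * M * (2 * (t - s) + h0) + M
     + (t - s) * (L * (2 * rate s)))) => n.
  have [j [E j1 j2]] := split_index s t n s0 st.
  have h := ltW (mesh_gt0 n); have hh := mesh_le n.
  have y1 := YE t x n t0; have y2 := YE s x n s0.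
  have y3 := eiter_taylor n (eindex n s) j x.
  have vs : `|V (approx n s) x| <= M by apply: V_bound; exact: good_eiter.
  have vd : `|V (approx n s) x - V (Y s) x| <= L * (2 * rate s * mesh n).
    apply: V_lip; [exact: good_eiter|exact: gY|move=> y].
    by rewrite distrC; exact: YE.
  set jh := j%:R * mesh n in j1 j2 y3.
  have jh0 : 0 <= jh by rewrite mulr_ge0.
  have y4 : `|(jh - (t - s)) * V (approx n s) x| <= mesh n * M.
    rewrite normrM ler_pM// ler_norml; apply/andP; split; lra.
  have y5 : `|(t - s) * (V (approx n s) x - V (Y s) x)| <= (t - s) * (L * (2 * rate s * mesh n)).
    by rewrite normrM ger0_norm// ler_wpM2l.
  have y6 : jh ^+ 2 <= (t - s) ^+ 2 + (2 * (t - s) + h0) * mesh n.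
    apply: (@le_trans _ _ ((t - s + mesh n) ^+ 2)); first by rewrite lerXn2r ?nnegrE// addr_ge0.
    have -> : (t - s + mesh n) ^+ 2 = (t - s) ^+ 2 + (2 * (t - s) + mesh n) * mesh n by ring.
    by rewrite lerD2l ler_wpM2r// lerD2l.
  have LM : 0 <= L * M by rewrite mulr_ge0.
  have y7 := ler_wpM2l LM y6.
  have -> : Y t x - Y s x - (t - s) * V (Y s) x =
    ((Y t x - approx n t x) - (Y s x - approx n s x)) +
    ((approx n t x - approx n s x - jh * V (approx n s) x) +
     ((jh - (t - s)) * V (approx n s) x + (t - s) * (V (approx n s) x - V (Y s) x))) by ring.
  rewrite -E -/(approx n s) in y3.
  apply: le_trans (ler_normD _ _) _.
  apply: le_trans (lerD (le_trans (ler_normB _ _) (lerD y1 y2))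
    (le_trans (ler_normD _ _) (lerD (le_trans y3 y7) (le_trans (ler_normD _ _) (lerD y4 y5))))) _.
  by rewrite le_eqVlt; apply/orP; left; apply/eqP; ring.
Qed.

End euler_scheme.

(** * From one-sided Taylor estimates to an integral identity *)

Section fundamental_theorem.
Context {R : realType}.

Lemma near_dist_le (s e : R) : 0 < e -> \forall r \near s, `|r - s| <= e.
Proof. by move=> e0; apply/nbhs_ballP; exists e => // r; rewrite /ball/= distrC => /ltW. Qed.

Variables (f g : R -> R) (t C : R).
Hypotheses (t0 : 0 < t).
Hypothesis fg : forall s r, 0 <= s -> s <= r -> r <= t + 1 ->
  `|f r - f s - (r - s) * g s| <= C * (r - s) ^+ 2.

Let C0 : 0 <= C.
Proof.
have := fg (lexx 0) (ltW t0); rewrite lerDl => /(_ ler01)/(le_trans (normr_ge0 _)).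
by rewrite pmulr_lge0// subr0 exprn_gt0.
Qed.

(* Compare the expansions at s with steps r - s and 2 (r - s) with the one at r. *)
Lemma taylor_lipschitz s r : 0 <= s -> s <= r -> r <= t -> r - s <= 1 ->
  `|g r - g s| <= 6 * C * (r - s).
Proof.
move=> s0 sr rt rs1; move: (sr); rewrite le_eqVlt => /predU1P[<-|lsr].
  by rewrite !subrr normr0 mulr0.
have d0 : 0 < r - s by rewrite subr_gt0.
pose q := r + (r - s).
have rq : r <= q by rewrite lerDl ltW.
have qt : q <= t + 1 by rewrite lerD.
have r0 : 0 <= r by exact: le_trans sr.
have A := fg s0 sr (le_trans rt (ltW (ltr_pwDr ltr01 (lexx t)))).
have B := fg r0 rq qt.
have D := fg s0 (le_trans sr rq) qt.
have E1 : q - r = r - s by rewrite /q; ring.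
have E2 : q - s = 2 * (r - s) by rewrite /q; ring.
rewrite E1 in B; rewrite E2 in D.
rewrite -(ler_pM2l d0) -{1}(gtr0_norm d0) -normrM.
have -> : (r - s) * (g r - g s) = (f q - f s - 2 * (r - s) * g s) -
  ((f r - f s - (r - s) * g s) + (f q - f r - (r - s) * g r)) by ring.
apply: le_trans (ler_normB _ _) _.
apply: le_trans (lerD D (le_trans (ler_normD _ _) (lerD A B))) _.
by rewrite le_eqVlt; apply/orP; left; apply/eqP; ring.
Qed.

(** For r < s, expand at r and exchange g(r) for g(s): 7 is 1 from the expansion plus 6 from
    [taylor_lipschitz]. *)
Lemma taylor_twosided s r : 0 <= s <= t -> 0 <= r <= t -> `|r - s| <= 1 ->
  `|f r - f s - (r - s) * g s| <= 7 * C * (r - s) ^+ 2.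
Proof.
move=> /andP[s0 st] /andP[r0 rt]; have [sr|/ltW rs] := leP s r.
  move=> _; apply: le_trans (fg s0 sr (le_trans rt (ltW (ltr_pwDr ltr01 (lexx t))))) _.
  by rewrite ler_wpM2r ?sqr_ge0// ler_peMl// ler1n.
rewrite distrC ger0_norm ?subr_ge0// => d1.
have A := fg r0 rs (le_trans st (ltW (ltr_pwDr ltr01 (lexx t)))).
have B := taylor_lipschitz r0 rs st d1.
have -> : f r - f s - (r - s) * g s =
  (s - r) * (g s - g r) - (f s - f r - (s - r) * g r) by ring.
apply: le_trans (ler_normB _ _) _; rewrite normrM ger0_norm ?subr_ge0//.
have sr0 : 0 <= s - r by rewrite subr_ge0.
apply: le_trans (lerD (ler_wpM2l sr0 B) A) _.
by rewrite le_eqVlt; apply/orP; left; apply/eqP; ring.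
Qed.

Lemma within_continuous_of_lip (k : R -> R) :
  (forall s, 0 <= s <= t -> exists K, forall r, 0 <= r <= t -> `|r - s| <= 1 ->
     `|k r - k s| <= K * `|r - s|) ->
  {within `[0, t], continuous k}.
Proof.
move=> kK; apply/subspace_continuousP => s /=; rewrite in_itv/= => st.
have [K kl] := kK s st.
apply/cvgrPdist_le => e e0; rewrite near_withinE; near=> r.
rewrite /= in_itv/= => rt; rewrite distrC.
have r1 : `|r - s| <= 1.
  by near: r; exact: near_dist_le.
apply: le_trans (kl r rt r1) _.
apply: (@le_trans _ _ ((`|K| + 1) * `|r - s|)).
  by rewrite ler_wpM2r// (le_trans (ler_norm _))// lerDl.
have K1 : 0 < `|K| + 1 by rewrite ltr_wpDl.
rewrite -ler_pdivlMl// mulrC.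
by near: r; apply: near_dist_le; rewrite divr_gt0.
Unshelve. all: by end_near. Qed.

(** The expansion alone makes g continuous on [0, t] and equal to f' inside, which is what the
    fundamental theorem requires. *)
Lemma integral_of_taylor :
  (\int[@lebesgue_measure R]_(s in `[0%R, t]) (g s)%:E = (f t - f 0)%:E)%E.
Proof.
have cg : {within `[0, t], continuous g}.
  apply: within_continuous_of_lip => s /andP[s0 st]; exists (6 * C) => r /andP[r0 rt] d.
  have [sr|/ltW rs] := leP s r.
    by rewrite (@ger0_norm _ (r - s)) ?subr_ge0// taylor_lipschitz// (le_trans (ler_norm _) d).
  rewrite (distrC (g r)) (distrC r) (@ger0_norm _ (s - r)) ?subr_ge0//.
  by rewrite taylor_lipschitz// (le_trans (ler_norm _))// distrC.
have cf : {within `[0, t], continuous f}.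
  apply: within_continuous_of_lip => s st; exists (7 * C + `|g s|) => r rt d.
  have := taylor_twosided st rt d => h.
  have -> : f r - f s = (f r - f s - (r - s) * g s) + (r - s) * g s by ring.
  apply: le_trans (ler_normD _ _) _; rewrite [leRHS]mulrDl; apply: lerD.
    apply: le_trans h _; apply: ler_wpM2l; first by rewrite mulr_ge0.
    by rewrite -(real_normK (num_real (r - s))) expr2 ler_piMl.
  by rewrite normrM mulrC.
have df s : s \in `]0, t[ -> is_derive s (1 : R) f (g s).
  rewrite in_itv/= => /andP[s0 st].
  pose k h := f (h *: (1 : R) + s) - f s - h * g s.
  have dk : is_derive (0 : R) (1 : R) k 0.
    apply: (@is_derive_sq_bound _ _ (7 * C)); near=> h.
    have hs : h *: (1 : R) + s - s = h by rewrite addrK; exact: mulr1.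
    have := @taylor_twosided s (h *: (1 : R) + s); rewrite /k hs; apply.
    + by rewrite !ltW.
    + have : `|h| <= Num.min s (t - s).
        by rewrite -[h]subr0; near: h; apply: near_dist_le; rewrite lt_min s0 subr_gt0.
      rewrite [h *: 1]mulr1 le_min !ler_norml => /andP[/andP[h1 h2] /andP[h3 h4]].
      by apply/andP; split; lra.
    + by rewrite -[h]subr0; near: h; exact: near_dist_le.
  apply/is_derive_line.
  have dl : is_derive (0 : R) (1 : R) (fun h => g s * h + f s) (g s).
    have := smooth1_is_derive (smooth1_affine (g s) (f s)) 0.
    have H : is_derive (0:R) (1:R) ((cst (g s) * id) + cst (f s)) (g s).
      have K := is_deriveD (is_deriveM (is_derive_cst (g s) (0:R) (1:R)) (is_derive_id (0:R) (1:R))) (is_derive_cst (f s) (0:R) (1:R)).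
      by apply: (is_derive_eq K); rewrite /GRing.scale/= /cst mulr1 mulr0 !addr0.
    by move=> _; exact: H.
  have H := is_deriveD dk dl; rewrite add0r in H.
  rewrite (_ : (fun h : R => _) = k + (fun h => g s * h + f s)); first exact: H.
  apply/funext => h; change (f (h *: (1 : R) + s) = k h + (g s * h + f s)).
  by rewrite /k; ring.
have [_ f0 ft] := (continuous_within_itvP f t0).1 cf.
rewrite (continuous_FTC2 t0 cg (F := f)) ?EFinB//.
- by split=> // s st; case: (df s st).
- by move=> s st; rewrite derive1E; exact: (@derive_val _ _ _ _ _ _ _ (df s st)).
Unshelve. all: by end_near. Qed.

End fundamental_theorem.

(** * The characteristic flow *)

Section existence.
Context {R : realType}.
Local Notation plane := (measurableTypeR R * measurableTypeR R)%type.

Definition image_probability (P : @planar_probability R) (T : plane -> plane)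
    (mT : measurable_fun setT T) : @planar_probability R :=
  distribution P (MeasurableFun.Pack (MeasurableFun.Class (isMeasurableFun.Build _ _ _ _ T mT))).

Definition clip (l u x : R) : R := Num.max l (Num.min u x).

Lemma clip_itv l u x : l <= u -> l <= clip l u x <= u.
Proof. by move=> lu; rewrite /clip le_max lexx ge_max lu ge_min lexx. Qed.

Lemma clip_id l u x : l <= x <= u -> clip l u x = x.
Proof. by move=> /andP[lx xu]; rewrite /clip (min_idPr xu) (max_idPr lx). Qed.

Lemma measurable_clip l u : measurable_fun [set: R] (clip l u).
Proof.
apply: measurable_maxr; first exact: measurable_cst.
by apply: measurable_minr; [exact: measurable_cst|exact: measurable_id].
Qed.

Variables (sigma a b c d : R) (g : R -> R) (mu0 : @planar_probability R).
Hypotheses (sigma0 : 0 < sigma) (a0 : 0 < a) (ab : a <= b) (cd : c <= d).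
Hypotheses (sg : smooth1 g) (ga : g a <= c) (gb : d <= g b).
Let B := box a b c d.
Hypothesis mu0B : mu0 (~` B) = 0%E.
Let mB : measurable (B : set plane) := measurable_box a b c d.
Let BT : B `<=` setT. Proof. by []. Qed.
Local Notation I f := (\int[mu0]_x f x).
Local Notation drift := (drift sigma g).

Definition good (Y : R * R -> R) : Prop :=
  measurable_fun [set: plane] (Y : plane -> R) /\ forall x, a <= Y x <= b.

(* The label theta does not evolve; clipping it only serves to send the whole plane into the box. *)
Definition charac (Y : R * R -> R) (x : R * R) : R * R := (Y x, clip c d x.2).

(** The mean of [Y] under [mu0] is the barycenter of the image measure, so this is the
    self-consistent velocity along characteristics. *)
Definition speed (Y : R * R -> R) (x : R * R) : R := I Y + drift (charac Y x).

Lemma charac_box Y x : good Y -> B (charac Y x).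
Proof. by move=> [_ Yab]; apply/boxP; split => //=; exact: clip_itv. Qed.

Lemma measurable_charac Y : good Y -> measurable_fun [set: plane] (charac Y : plane -> plane).
Proof.
move=> [mY _]; apply: measurable_fun_pair; first exact: mY.
exact (measurableT_comp (measurable_clip c d) (@measurable_snd _ _ (measurableTypeR R) (measurableTypeR R))).
Qed.

Lemma measurable_comp_charac Y (F : R * R -> R) : good Y ->
  measurable_fun [set: plane] (F : plane -> R) ->
  measurable_fun [set: plane] (fun x : plane => F (charac Y x)).
Proof. by move=> gY mF; exact: (measurableT_comp mF (measurable_charac gY)). Qed.

Lemma tame_good Y : good Y -> tame B Y.
Proof.
move=> [mY Yab]; split => //; exists b => x _; have /andP[h1 h2] := Yab x.
by rewrite ger0_norm// (le_trans (ltW a0)).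
Qed.

Lemma mean_good Y : good Y -> a <= I Y <= b.
Proof.
move=> gY; have tY := tame_good gY; have [_ Yab] := gY; apply/andP; split.
  rewrite -[leLHS](mean_cst mB mu0B measurableT BT a).
  by apply: (mean_le mB mu0B measurableT BT (tame_cst B a) tY) => x _; case/andP: (Yab x).
rewrite -[leRHS](mean_cst mB mu0B measurableT BT b).
by apply: (mean_le mB mu0B measurableT BT tY (tame_cst B b)) => x _; case/andP: (Yab x).
Qed.

Let cdrift : continuous drift := alg_continuous (alg_drift sigma sg).

Lemma characteristics : exists (Y : R -> R * R -> R) (M L : R),
  [/\ 0 <= M, 0 <= L, forall x, Y 0 x = clip a b x.1,
      forall t, 0 <= t -> good (Y t) &
      (forall t x, 0 <= t -> `|speed (Y t) x| <= M) /\
      forall s t x, 0 <= s -> s <= t -> `|Y t x - Y s x| <= M * (t - s) /\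
        `|Y t x - Y s x - (t - s) * speed (Y s) x| <= L * (t - s) ^+ 2].
Proof.
have [h0 /andP[h00 h01] Hh] := euler_box sigma0 a0 ab sg ga gb.
have [V1 V10 HV1] := @continuous_bound_box R a b c d _ cdrift.
have [W W0 HW] := @continuous_bound_box R a b c d _ (alg_continuous (alg_D1 (alg_drift sigma sg))).
have b0 : 0 <= b by rewrite (le_trans (ltW a0)).
have gstep Y h : good Y -> 0 <= h <= h0 -> good (fun x => Y x + h * speed Y x).
  move=> gY hh; have [mY Yab] := gY; split=> [|x]; last first.
    exact: (Hh (I Y) h (charac Y x) (mean_good gY) hh (charac_box x gY)).
  have ms := measurable_comp_charac gY (continuous_measurable2 cdrift).
  have mc k : measurable_fun [set: plane] (fun _ : plane => k : R) by exact: measurable_cst.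
  exact: (measurable_funD mY (measurable_funM (mc h) (measurable_funD (mc (I Y)) ms))).
have sM Y x : good Y -> `|speed Y x| <= b + V1.
  move=> gY; apply: le_trans (ler_normD _ _) _; apply: lerD; last by apply: HV1; exact: charac_box.
  have /andP[h1 h2] := mean_good gY; by rewrite ger0_norm// (le_trans (ltW a0)).
(* In the Lipschitz constant 1 + W, the 1 is due to the mean and W to the drift. *)
have slip Y Z (e : R) : good Y -> good Z -> (forall x, `|Y x - Z x| <= e) ->
    forall x, `|speed Y x - speed Z x| <= (1 + W) * e.
  move=> gY gZ YZ x; rewrite /speed opprD addrACA mulrDl mul1r.
  apply: le_trans (ler_normD _ _) _; apply: lerD.
    by apply: (mean_dist_le mB mu0B measurableT BT (tame_good gY) (tame_good gZ)) => y _.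
  have [_ Yab] := gY; have [_ Zab] := gZ.
  have cl : c <= clip c d x.2 <= d by exact: clip_itv.
  have L := @lipschitz_of_derive _ (fun r => drift (r, clip c d x.2))
    (fun r => D1 drift (r, clip c d x.2)) a b W _ _ (Z x) (Y x) (Zab x) (Yab x).
  apply: le_trans (L _ _) _ => [r rab|r rab|].
  - by apply: alg_slice; exact: alg_drift.
  - by apply: HW; apply/boxP.
  - by rewrite ler_wpM2l.
have g0 : good (fun x => clip a b x.1).
  split=> [|x]; last exact: clip_itv.
  exact (measurableT_comp (measurable_clip a b) (@measurable_fst _ _ (measurableTypeR R) (measurableTypeR R))).
have glim (u : nat -> R * R -> R) l : (forall n, good (u n)) ->
    (forall x, u n x @[n --> \oo] --> (l x : R)) -> good l.
  move=> gu ul; split.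
    apply: (@measurable_fun_cvg _ plane R setT u l) => [n|x _]; first by case: (gu n).
    exact: ul.
  move=> x; rewrite -(cvg_lim _ (ul x))//; have cu : cvgn (fun n => u n x) by apply/cvg_ex; exists (l x).
  by apply/andP; split; [apply: limr_ge|apply: limr_le] => //; apply: nearW => n;
    case: (gu n) => _ /(_ x)/andP[].
have M0 : 0 <= b + V1 by rewrite addr_ge0.
have L0 : 0 <= 1 + W by rewrite addr_ge0.
have [Y [Y0 gY Y1 Y2]] := euler_limit h00 L0 M0 g0 gstep sM slip glim.
exists Y, (b + V1), ((1 + W) * (b + V1)); split => //; first exact: mulr_ge0.
split=> [t x t0|s t x s0 st]; first exact/sM/gY.
by split; [exact: Y1|exact: Y2].
Qed.

End existence.

(** * Expansion of test functions in time and y *)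

Section test_function_expansion.
Context {R : realType}.
Implicit Types (phi : R * (R * R) -> R).

Lemma derivable_dt phi : Ck 1 phi -> forall r x, is_derive r (1 : R) (fun r => phi (r, x)) (dt phi (r, x)).
Proof.
move=> [_ /(_ (1, (0, 0)))[D _]] r x.
have /is_derive_line H := derivableP (D (r, x)).
apply/is_derive_line; rewrite -/(dt phi) in H.
rewrite (_ : (fun h : R => _) = (fun h : R => phi (h *: ((1, (0, 0)) : R * (R * R)) + (r, x)))); first exact: H.
apply/funext => h; congr phi; congr pair => /=.
by have -> : h *: ((0, 0) : R * R) = 0 by [exact: scaler0]; rewrite add0r.
Qed.

Lemma derivable_dy phi : Ck 1 phi -> forall (s r t : R),
  is_derive r (1 : R) (fun r => phi (s, (r, t))) (dy phi (s, (r, t))).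
Proof.
move=> [_ /(_ (0, (1, 0)))[D _]] s r t.
have /is_derive_line H := derivableP (D (s, (r, t))).
apply/is_derive_line; rewrite -/(dy phi) in H.
rewrite (_ : (fun h : R => _) = (fun h : R => phi (h *: ((0, (1, 0)) : R * (R * R)) + (s, (r, t))))); first exact: H.
apply/funext => h; congr phi; congr pair => /=; first by rewrite [_ *: 0]mulr0 add0r.
by congr pair; rewrite /= [_ *: 0]mulr0 add0r.
Qed.

(** The increment is split as (s, y) to (s, z) to (r, z). The second leg produces the time
    derivative at z; moving it to y gives the mixed term. *)
Lemma expansion phi (tmax a b c d : R) : smooth phi ->
  exists2 C : R, 0 <= C & forall (s r y z t : R),
    0 <= s <= tmax -> 0 <= r <= tmax -> a <= y <= b -> a <= z <= b -> c <= t <= d ->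
    `|dy phi (s, (y, t))| <= C /\
    `|phi (r, (z, t)) - phi (s, (y, t)) - (r - s) * dt phi (s, (y, t)) - (z - y) * dy phi (s, (y, t))|
      <= C * ((r - s) ^+ 2 + `|r - s| * `|z - y| + (z - y) ^+ 2).
Proof.
move=> sphi; have [_ c2] := sphi 2.
have cdt : Ck 1 (dt phi) by case: (c2 (1, (0, 0))).
have cdy : Ck 1 (dy phi) by case: (c2 (0, (1, 0))).
pose K : set (R * (R * R)) := `[0, tmax]%classic `*` box a b c d.
have cK : compact K by apply: compact_setX; [exact: segment_compact|exact: compact_box].
have bound (f : R * (R * R) -> R) : continuous f -> exists2 C : R, 0 <= C & forall x, K x -> `|f x| <= C.
  by move=> cf; apply: compact_norm_bound => //; exact: continuous_subspaceT.
have [C1 C10 H1] := bound _ (proj1 cdy).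
have [C2 C20 H2] := bound _ (proj2 (proj2 cdt (1, (0, 0)))).
have [C3 C30 H3] := bound _ (proj2 (proj2 cdt (0, (1, 0)))).
have [C4 C40 H4] := bound _ (proj2 (proj2 cdy (0, (1, 0)))).
exists (C1 + (C2 + (C3 + C4))); first by rewrite !addr_ge0.
move=> s r y z t st rt yab zab tcd.
have inK u v : 0 <= u <= tmax -> a <= v <= b -> K (u, (v, t)).
  by move=> hu hv; split; [rewrite /= in_itv|apply/boxP].
have D1 := derivable_dt (sphi 1%N); have D2 := derivable_dt cdt; have D3 := derivable_dy cdt.
have D4 := derivable_dy (sphi 1%N); have D5 := derivable_dy cdy.
split; first by apply: le_trans (H1 _ (inK s y st yab)) _; rewrite lerDl !addr_ge0.
have T1 := @taylor2 R (fun r => phi (r, (z, t))) (fun r => dt phi (r, (z, t)))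
  (fun r => dt (dt phi) (r, (z, t))) 0 tmax C2.
have {}T1 : `|phi (r, (z, t)) - phi (s, (z, t)) - (r - s) * dt phi (s, (z, t))| <= C2 * (r - s) ^+ 2.
  exact: (T1 (fun u _ => D1 u (z, t)) (fun u _ => D2 u (z, t)) (fun u hu => H2 _ (inK u z hu zab)) _ _ st rt).
have T2 : `|dt phi (s, (z, t)) - dt phi (s, (y, t))| <= C3 * `|z - y|.
  exact: (@lipschitz_of_derive R (fun y => dt phi (s, (y, t))) (fun y => dy (dt phi) (s, (y, t))) a b C3
    (fun u _ => D3 s u t) (fun u hu => H3 _ (inK s u st hu)) _ _ yab zab).
have T3 := @taylor2 R (fun y => phi (s, (y, t))) (fun y => dy phi (s, (y, t)))
  (fun y => dy (dy phi) (s, (y, t))) a b C4.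
have {}T3 : `|phi (s, (z, t)) - phi (s, (y, t)) - (z - y) * dy phi (s, (y, t))| <= C4 * (z - y) ^+ 2.
  exact: (T3 (fun u _ => D4 s u t) (fun u _ => D5 s u t) (fun u hu => H4 _ (inK s u st hu)) _ _ yab zab).
have -> : phi (r, (z, t)) - phi (s, (y, t)) - (r - s) * dt phi (s, (y, t)) - (z - y) * dy phi (s, (y, t)) =
  (phi (r, (z, t)) - phi (s, (z, t)) - (r - s) * dt phi (s, (z, t))) +
  ((r - s) * (dt phi (s, (z, t)) - dt phi (s, (y, t))) +
   (phi (s, (z, t)) - phi (s, (y, t)) - (z - y) * dy phi (s, (y, t)))) by ring.
apply: le_trans (ler_normD _ _) _.
apply: (@le_trans _ _ (C2 * (r - s) ^+ 2 + (C3 * (`|r - s| * `|z - y|) + C4 * (z - y) ^+ 2))).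
  apply: lerD => //; apply: le_trans (ler_normD _ _) _; apply: lerD => //.
  by rewrite normrM mulrCA ler_wpM2l.
have widen (x A E : R) : 0 <= x -> 0 <= E -> C1 + (C2 + (C3 + C4)) = A + E -> A * x <= (C1 + (C2 + (C3 + C4))) * x.
  by move=> x0 E0 ->; rewrite mulrDl lerDl mulr_ge0.
rewrite addrA 2!mulrDr; apply: lerD; first apply: lerD.
- by apply: (widen _ _ (C1 + (C3 + C4))); [exact: sqr_ge0|rewrite !addr_ge0|ring].
- by apply: (widen _ _ (C1 + (C2 + C4))); [rewrite mulr_ge0|rewrite !addr_ge0|ring].
- by apply: (widen _ _ (C1 + (C2 + C3))); [exact: sqr_ge0|rewrite !addr_ge0|ring].
Qed.

End test_function_expansion.

(** * The image measures solve the equation *)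

Section solution.
Context {R : realType}.
Local Notation plane := (measurableTypeR R * measurableTypeR R)%type.
Variables (sigma p a b c d : R) (g : R -> R) (mu0 : @planar_probability R).
Hypotheses (a0 : 0 < a) (c0 : 0 < c) (cd : c <= d) (sg : smooth1 g).
Hypothesis gp : forall y, a <= y <= b -> g y = y `^ p.
Let B := box a b c d.
Hypothesis mu0B : mu0 (~` B) = 0%E.
Let mB : measurable (B : set plane) := measurable_box a b c d.
Let mO := @measurable_Omega R.
Let BO : B `<=` Omega := box_Omega a0 c0.
Let BT : B `<=` setT. Proof. by []. Qed.
Local Notation I f := (\int[mu0]_x f x).
Local Notation drift := (drift sigma g).
Local Notation charac := (charac c d).
Local Notation good := (good a b).
Local Notation speed := (speed sigma c d g mu0).

Variables (Y : R -> R * R -> R) (M L : R).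
Hypotheses (M0 : 0 <= M) (Y0 : forall x, Y 0 x = clip a b x.1).
Hypothesis gY0 : forall t, 0 <= t -> good (Y t).
Hypothesis Ylip : forall s t x, 0 <= s -> s <= t -> `|Y t x - Y s x| <= M * (t - s).
Hypothesis Ytaylor : forall s t x, 0 <= s -> s <= t ->
  `|Y t x - Y s x - (t - s) * speed (Y s) x| <= L * (t - s) ^+ 2.

(** Truncation at 0 makes [path t] good for every real t, as needed to define an image measure at
    all times. *)
Definition path (t : R) : R * R -> R := Y (Num.max 0 t).

Let gY t : good (path t). Proof. by apply: gY0; rewrite le_max lexx. Qed.

Let pathE t : 0 <= t -> path t = Y t. Proof. by move=> t0; rewrite /path (max_idPr t0). Qed.

Let charB t x : B (charac (path t) x). Proof. exact: charac_box. Qed.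

Definition evolution (t : R) : @planar_probability R :=
  image_probability mu0 (measurable_charac c d (gY t)).

Lemma evolution_box t : evolution t (~` B) = 0%E.
Proof.
change (mu0 (charac (path t) @^-1` (~` B)) = 0%E).
rewrite (_ : _ @^-1` _ = set0) ?measure0//.
by apply/seteqP; split=> // x /=; apply; exact: charB.
Qed.

Let tame_comp t (F : R * R -> R) : measurable_fun [set: plane] (F : plane -> R) ->
  (exists C, forall x, B x -> `|F x| <= C) -> tame B (fun x => F (charac (path t) x)).
Proof.
move=> mF [C FC]; split; first exact: measurable_comp_charac.
by exists C => x _; exact: FC.
Qed.

Lemma evolution_integral t (F : R * R -> R) : tame B F ->
  (\int[evolution t]_(x in Omega) (F x)%:E = (I (fun x => F (charac (path t) x)))%:E)%E.
Proof.
move=> [mF FC]; have tc := tame_comp t mF FC.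
have E : charac (path t) @^-1` Omega = setT.
  by apply/seteqP; split=> // x _ /=; apply: BO; exact: charB.
have iF : mu0.-integrable (charac (path t) @^-1` Omega) ((EFin \o F) \o charac (path t)).
  by rewrite E; exact: (tame_integrable mB mu0B measurableT BT tc).
have mEF : measurable_fun [set: plane] (EFin \o F) by exact/measurable_EFinP.
have := integral_pushforward (measurable_charac c d (gY t)) mEF iF mO.
rewrite E => H; transitivity (\int[mu0]_x ((EFin \o F) \o charac (path t)) x)%E; first exact: H.
exact: (tame_integralE mB mu0B measurableT BT tc).
Qed.

Lemma evolution_mean t (F : R * R -> R) : tame B F ->
  \int[evolution t]_(x in Omega) F x = I (fun x => F (charac (path t) x)).
Proof. by move=> tF; rewrite /Rintegral evolution_integral. Qed.

Lemma evolution_P0 t : in_P0 (evolution t).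
Proof.
have sB : supp (evolution t) `<=` B.
  by apply: supp_sub; [exact: closed_box|exact: evolution_box].
split; last exact: subset_trans BO.
by apply: subclosed_compact sB; [exact: closed_supp|exact: compact_box].
Qed.

Lemma path_lip s t x : `|path t x - path s x| <= M * `|t - s|.
Proof.
wlog st : s t / s <= t => [H|].
  have [|/ltW] := leP s t; first exact: H.
  by move=> ts; rewrite distrC (distrC t); exact: H.
have m0 (r : R) : 0 <= Num.max 0 r by rewrite le_max lexx.
have mst : Num.max 0 s <= Num.max 0 t by rewrite ge_max le_max lexx /= le_max st orbT.
apply: le_trans (Ylip x (m0 s) mst) _; rewrite ler_wpM2l// (ger0_norm (_ : 0 <= t - s)) ?subr_ge0//.
have [s0|s0] := leP s 0; have [t0|t0] := leP t 0.
- by rewrite subrr subr_ge0.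
- by rewrite subr0 lerBrDr ler_wnDr.
- by have := lt_le_trans s0 (le_trans st t0); rewrite ltxx.
- by [].
Qed.

Lemma path_continuous x : continuous (fun t => path t x).
Proof.
have M1 : 0 < M + 1 by rewrite ltr_wpDl.
move=> s; apply/cvgrPdist_le => e e0; near=> t; rewrite distrC.
apply: le_trans (path_lip s t x) _.
apply: (@le_trans _ _ ((M + 1) * `|t - s|)); first by rewrite ler_wpM2r// lerDl.
rewrite -ler_pdivlMl// mulrC.
by near: t; apply: near_dist_le; exact: divr_gt0.
Unshelve. all: by end_near. Qed.

(** Each characteristic is continuous in t and stays in the box, where [f] is bounded; dominated
    convergence along sequences concludes. *)
Lemma evolution_weak_star I0 : weak_star_continuous I0 evolution.
Proof.
move=> f [cf _]; have tf := tame_continuous a b c d cf.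
suff C : continuous (fun t : R => I (fun x => f (charac (path t) x))).
  rewrite (_ : (fun t => _) = (fun t : R => I (fun x => f (charac (path t) x)))).
    exact: continuous_subspaceT.
  by apply/funext => t; exact: evolution_mean.
move=> s; apply/(@cvg_nbhsP _ R^o) => u us.
have [K K0 fK] := continuous_bound_box a b c d cf.
have tc t := tame_comp t (proj1 tf) (proj2 tf).
have [|||||_ _] := @dominated_convergence _ plane R mu0 setT measurableT
  (fun n x => (f (charac (path (u n)) x))%:E) (fun x => (f (charac (path s) x))%:E) (cst K%:E).
- by move=> n; apply/measurable_EFinP; case: (tc (u n)).
- by apply/measurable_EFinP; case: (tc s).
- apply: aeW => x _; apply: cvg_EFin; first exact: nearW.
  have pc : path (u n) x @[n --> \oo] --> path s x.
    exact: (cvg_comp _ _ us (@path_continuous x s)).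
  have pc2 : charac (path (u n)) x @[n --> \oo] --> charac (path s) x.
    exact: (cvg_pair pc (cvg_cst _)).
  exact: (cvg_comp _ _ pc2 (cf (charac (path s) x))).
- exact: finite_measure_integrable_cst.
- by apply: aeW => x n _; rewrite lee_fin; exact: (fK _ (charB _ _)).
rewrite (tame_integralE mB mu0B measurableT BT (tc s)) => H.
exact: fine_cvg H.
Qed.

(** At time 0 the characteristic map is the clipping, which is the identity on the box carrying
    [mu0]. *)
Lemma evolution0 : same_measure (evolution 0) mu0.
Proof.
move=> A mA; change (mu0 (charac (path 0) @^-1` A) = mu0 A).
have mP : measurable (charac (path 0) @^-1` A : set plane).
  by rewrite -[_ @^-1` _]setTI; apply: (measurable_charac c d (gY 0)).
have E (X : set plane) : measurable X -> mu0 X = mu0 (X `&` B).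
  move=> mX; rewrite (measureDI mu0 mX mB) -[RHS]add0e; congr (_ + _)%E.
  apply/eqP; rewrite eq_le measure_ge0 andbT -mu0B le_measure// ?inE//.
  - exact: measurableD.
  - exact: measurableC.
rewrite E// [RHS]E//; congr (mu0 _); apply/seteqP; split=> x /= [Ax Bx]; split => //.
all: have [x1 x2] := proj1 (boxP a b c d x) Bx; move: Ax;
  by rewrite /charac pathE// Y0 !clip_id//; case: (x).
Qed.

Definition generator (phi : R * (R * R) -> R) (s : R) (x : R * R) : R :=
  dt phi (s, x) + (I (path s) + drift x) * dy phi (s, x).

Lemma continuous_generator phi s : smooth phi -> continuous (generator phi s).
Proof.
move=> sphi; have [_ c2] := sphi 1%N.
have cdt : continuous (dt phi) by case: (c2 (1, (0, 0))).
have cdy : continuous (dy phi) by case: (c2 (0, (1, 0))).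
have c1 : continuous (fun x => dt phi (s, x)) := slice_continuous (s := s) cdt.
have c3 : continuous (fun x => dy phi (s, x)) := slice_continuous (s := s) cdy.
have c4 : continuous drift := alg_continuous (alg_drift sigma sg).
by move=> x; exact: (cvgD (c1 x) (cvgM (cvgD (cvg_cst (I (path s))) (c4 x)) (c3 x))).
Qed.

Lemma path_mean s : \int[evolution s]_(x in Omega) x.1 = I (path s).
Proof.
by rewrite evolution_mean//; apply: tame_continuous => x; exact: cvg_fst.
Qed.

Lemma evolution_rhs phi s : smooth phi -> 0 <= s ->
  (\int[evolution s]_(x in Omega) (dt phi (s, x) +
      velocity sigma p (evolution s) x * dy phi (s, x))%:E =
   (I (fun x => generator phi s (charac (path s) x)))%:E)%E.
Proof.
move=> sphi s0.
have cG := continuous_generator (s := s) sphi.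
have [_ c2] := sphi 1%N.
have cdt : continuous (dt phi) by case: (c2 (1, (0, 0))).
have cdy : continuous (dy phi) by case: (c2 (0, (1, 0))).
have vE x := @velocityE R sigma p a b c d evolution a0 c0 (fun t _ => evolution_box t) s x s0.
have E x : B x -> dt phi (s, x) + velocity sigma p (evolution s) x * dy phi (s, x) = generator phi s x.
  move=> Bx; rewrite vE /barycenter path_mean /generator /drift.
  have [x1 _] := proj1 (boxP a b c d x) Bx.
  by rewrite gp//; congr (_ + _ * _); ring.
have tl : tame B (fun x => dt phi (s, x) + velocity sigma p (evolution s) x * dy phi (s, x)).
  have [mG [C GC]] := tame_continuous a b c d cG.
  split; last by exists C => x Bx; rewrite E// GC.
  have mta := continuous_measurable2 (slice_continuous (s := s) cdt).
  have mtb := continuous_measurable2 (slice_continuous (s := s) cdy).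
  have m1 : measurable_fun [set: plane] (fst : plane -> R) by exact: measurable_fst.
  have m2 : measurable_fun [set: plane] (snd : plane -> R) by exact: measurable_snd.
  have mp : measurable_fun [set: plane] ((@powR R ^~ p) \o (fst : plane -> measurableTypeR R)).
    exact (measurableT_comp (@measurable_powR R p) (@measurable_fst _ _ (measurableTypeR R) (measurableTypeR R))).
  have mv : measurable_fun [set: plane] (fun x : plane => velocity sigma p (evolution s) x).
    rewrite (_ : (fun x : plane => _) = (fun x : plane => barycenter evolution s - x.1 +
        sigma * (x.2 - (x.1 : R) `^ p) * x.1)); last by apply/funext => x; exact: vE.
    have mc k : measurable_fun [set: plane] (fun _ : plane => k : R) by exact: measurable_cst.
    exact: (measurable_funD (measurable_funB (mc _) m1)
      (measurable_funM (measurable_funM (mc _) (measurable_funB m2 mp)) m1)).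
  exact: (measurable_funD mta (measurable_funM mv mtb)).
rewrite evolution_integral//; congr (_%:E); apply: eq_Rintegral => x _.
by rewrite E.
Qed.

(** The integral f(s) of phi(s, .) inherits a Taylor expansion with derivative [G] by averaging that
    of phi along characteristics; [integral_of_taylor] then gives the weak form. *)
Lemma evolution_weak phi t : smooth phi -> 0 < t ->
  (\int[evolution t]_(x in Omega) (phi (t, x))%:E =
     \int[mu0]_(x in Omega) (phi (0, x))%:E +
     \int[@lebesgue_measure R]_(s in `[0%R, t])
       \int[evolution s]_(x in Omega)
         (dt phi (s, x) + velocity sigma p (evolution s) x * dy phi (s, x))%:E)%E.
Proof.
move=> sphi t0.
have cphi : continuous phi by exact: (sphi 0%N).
have tphi s : tame B (fun x => phi (s, x)) by exact/tame_continuous/slice_continuous.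
pose f s := I (fun x => phi (s, charac (path s) x)).
pose G s := I (fun x => generator phi s (charac (path s) x)).
have -> : (\int[mu0]_(x in Omega) (phi (0, x))%:E = (f 0)%:E)%E.
  rewrite -(evolution_integral 0 (tphi 0)); apply: eq_measure_integral => A mA _.
  by apply/esym; exact: evolution0.
rewrite (evolution_integral t (tphi t)) -/(f t).
have -> : (\int[@lebesgue_measure R]_(s in `[0%R, t])
       \int[evolution s]_(x in Omega)
         (dt phi (s, x) + velocity sigma p (evolution s) x * dy phi (s, x))%:E =
    \int[@lebesgue_measure R]_(s in `[0%R, t]) (G s)%:E)%E.
  apply: eq_integral => s; rewrite inE/= in_itv/= => /andP[s0 _].
  by rewrite evolution_rhs.
(* The horizon t + 1 is the one on which [integral_of_taylor] asks for the expansion. In the next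
   constant, 1 + M + M^2 bounds the remainder of phi through |z - y| <= M (r - s), and L that of the
   characteristic. *)
have [C C0 HC] := expansion (t + 1) a b c d sphi.
rewrite (@integral_of_taylor R f G t (C * (1 + M + M ^+ 2 + L)) t0).
  by rewrite -EFinD addrC subrK.
move=> s r s0 sr rt1; have r0 : 0 <= r by exact: le_trans sr.
have st1 : 0 <= s <= t + 1 by rewrite s0 (le_trans sr).
have rt : 0 <= r <= t + 1 by rewrite r0.
have tA u := tame_comp u (proj1 (tphi u)) (proj2 (tphi u)).
have tG0 := tame_continuous a b c d (continuous_generator (s := s) sphi).
have tG := tame_comp s (proj1 tG0) (proj2 tG0).
have -> : f r - f s - (r - s) * G s = I (fun x => phi (r, charac (path r) x) -
    phi (s, charac (path s) x) - (r - s) * generator phi s (charac (path s) x)).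
  rewrite (meanB mB mu0B measurableT BT (tameB (tA r) (tA s)) (tameM (tame_cst B (r - s)) tG)).
  rewrite (meanB mB mu0B measurableT BT (tA r) (tA s)).
  by rewrite (meanZ mB mu0B measurableT BT _ tG).
apply: (mean_norm_le mB mu0B measurableT BT).
  exact: (tameB (tameB (tA r) (tA s)) (tameM (tame_cst B (r - s)) tG)).
move=> x _; rewrite /charac !pathE//.
have [_ Ysab] := gY0 s0; have [_ Yrab] := gY0 r0.
have cl : c <= clip c d x.2 <= d by exact: clip_itv.
have [K1 K2] := HC s r (Y s x) (Y r x) (clip c d x.2) st1 rt (Ysab x) (Yrab x) cl.
have K3 := Ylip x s0 sr; have K4 := Ytaylor x s0 sr.
have rs : 0 <= r - s by rewrite subr_ge0.
set y := Y s x in K1 K2 K3 K4 *; set z := Y r x in K2 K3 K4 *; set th := clip c d x.2 in K1 K2 *.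
have -> : phi (r, (z, th)) - phi (s, (y, th)) - (r - s) * generator phi s (y, th) =
  (phi (r, (z, th)) - phi (s, (y, th)) - (r - s) * dt phi (s, (y, th)) - (z - y) * dy phi (s, (y, th))) +
  (z - y - (r - s) * speed (Y s) x) * dy phi (s, (y, th)).
  by rewrite /generator /speed /charac -/y -/th pathE//; ring.
apply: le_trans (ler_normD _ _) _.
apply: (@le_trans _ _ (C * ((r - s) ^+ 2 + (r - s) * (M * (r - s)) + (M * (r - s)) ^+ 2) + L * (r - s) ^+ 2 * C)).
  apply: lerD; last by rewrite normrM ler_pM.
  apply: le_trans K2 _; rewrite ler_wpM2l// (ger0_norm rs).
  apply: lerD; first by rewrite lerD2l ler_wpM2l.
  by rewrite -(real_normK (num_real (z - y))) lerXn2r ?nnegrE// mulr_ge0.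
by rewrite le_eqVlt; apply/orP; left; apply/eqP; ring.
Qed.

Lemma evolution_solution : global_solution sigma p mu0 evolution.
Proof.
move=> T T0; split.
- by move=> t _; exact: evolution_P0.
- exact: evolution_weak_star.
- exact: evolution0.
- by move=> phi [sphi _ _] t /andP[t0 _]; exact: evolution_weak.
Qed.

End solution.

(** * Invariant boxes and well-posedness *)

Section inside_Omega.
Context {R : realType}.

Lemma box_sub (a b c d a' b' c' d' : R) : a' <= a -> b <= b' -> c' <= c -> d <= d' ->
  box a b c d `<=` box a' b' c' d'.
Proof.
move=> aa bb cc dd x /boxP[/andP[h1 h2] /andP[h3 h4]]; apply/boxP; split.
  by rewrite (le_trans aa)//= (le_trans h2).
by rewrite (le_trans cc)//= (le_trans h4).
Qed.

(** Such a point is approached from Omega along the diagonal, through z + (e, e). *)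
Lemma frontier_OmegaP (z : R * R) : 0 <= z.1 -> 0 <= z.2 -> ~ Omega z -> frontier Omega z.
Proof.
move=> z1 z2 nz; split; last by move/interior_subset.
move=> B zB.
have c : (z.1 + e, z.2 + e) @[e --> (0 : R)] --> z.
  rewrite [X in _ --> X](_ : z = (z.1 + 0, z.2 + 0)); last by rewrite !addr0; case: (z).
  exact: (cvg_pair (cvgD (cvg_cst z.1) cvg_id) (cvgD (cvg_cst z.2) cvg_id)).
have /nbhs_ballP[e /= e0 eB] := c _ zB.
have e2 : 0 < e / 2 by rewrite divr_gt0.
exists (z.1 + e / 2, z.2 + e / 2); split; first by split; rewrite /= ltr_wpDl.
apply: eB; rewrite /ball/= sub0r normrN gtr0_norm//.
by rewrite ltr_pdivrMr// ltr_pMr// ltr1n.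
Qed.

Lemma frontier_Omega_le (z : R * R) : frontier Omega z -> z.1 <= 0 \/ z.2 <= 0.
Proof.
move=> [_]; rewrite ((interior_id _).1 open_Omega) => nz; case: (leP z.1 0) => z1; [by left|right].
by rewrite leNgt; apply/negP => z2; apply: nz.
Qed.

(** The distance from x to its projections (0, x.2) and (x.1, 0) on the frontier is x.1 and x.2, so
    separation from the frontier bounds both coordinates below. *)
Lemma inside_box (nu : R -> @planar_probability R) : uniformly_inside_Omega nu ->
  exists r M : R, 0 < r /\ forall t, 0 <= t -> supp (nu t) `<=` box r M r M.
Proof.
move=> [SO /pinfty_ex_gt0[M M0 SM] [r r0 far]].
exists r, M; split=> // t t0 x tx.
have Sx : (\bigcup_(t in [set t : R | 0 <= t]) supp (nu t)) x by exists t.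
have [x1 x2] := SO _ Sx.
have : `|x| <= M := SM _ Sx.
rewrite prod_normE ge_max => /andP[/= /ler_normlP[_ h1] /ler_normlP[_ h2]].
apply/boxP; rewrite h1 h2 !andbT; split.
  have /(far _ _ Sx) : frontier Omega (0, x.2).
    by apply: frontier_OmegaP => //=; [exact: ltW|case; rewrite /= ltxx].
  by rewrite prod_normE/= subr0 subrr normr0 (ger0_norm (ltW x1)) (max_idPl (ltW x1)).
have /(far _ _ Sx) : frontier Omega (x.1, 0).
  by apply: frontier_OmegaP => //=; [exact: ltW|case; rewrite /= ltxx].
by rewrite prod_normE/= subr0 subrr normr0 (ger0_norm (ltW x2)) (max_idPr (ltW x2)).
Qed.

Lemma box_inside (a b c d : R) (nu : R -> @planar_probability R) : 0 < a -> 0 < c ->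
  (forall t, 0 <= t -> nu t (~` box a b c d) = 0%E) -> uniformly_inside_Omega nu.
Proof.
move=> a0 c0 nuB.
have SB : \bigcup_(t in [set t : R | 0 <= t]) supp (nu t) `<=` box a b c d.
  by move=> x [t /= t0]; apply: supp_sub; [exact: closed_box|exact: nuB].
split; first by move=> x /SB /(box_Omega a0 c0).
  have := compact_bounded (@compact_box R a b c d).
  by rewrite /bounded_set /bounded_near; apply: filterS => M BM x /SB; exact: BM.
exists (Num.min a c); first by rewrite lt_min a0.
move=> x z /SB/boxP[/andP[ax _] /andP[cx _]] /frontier_Omega_le zO.
rewrite prod_normE/= le_max !ge_min; case: zO => z0; apply/orP; [left|right].
  by apply/orP; left; rewrite (le_trans _ (ler_norm _))// (le_trans ax)// lerBrDr gerDl.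
by apply/orP; right; rewrite (le_trans _ (ler_norm _))// (le_trans cx)// lerBrDr gerDl.
Qed.

(* On the box [a, b] x [r, M] the velocity points inwards at y = a and at y = b. *)
Lemma inward_box (p r M : R) : 0 < p -> 0 < r -> r <= M -> exists (a b : R) (g : R -> R),
  [/\ 0 < a <= r, M <= b, smooth1 g, forall y, a <= y <= b -> g y = y `^ p & g a <= r /\ M <= g b].
Proof.
move=> p0 r0 rM; have M0 := lt_le_trans r0 rM.
pose a := Num.min r (r `^ p^-1); pose b := Num.max M (M `^ p^-1).
have a0 : 0 < a by rewrite lt_min r0 powR_gt0.
have ar : a <= r by rewrite ge_min lexx.
have Mb : M <= b by rewrite le_max lexx.
have ab : a <= b := le_trans ar (le_trans rM Mb).
have root x : 0 < x -> x = (x `^ p^-1) `^ p.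
  by move=> x0; rewrite -powRrM mulVf ?gt_eqF// powRr1// ltW.
have mono x y : 0 <= x -> x <= y -> x `^ p <= y `^ p.
  by move=> x0 xy; apply: ge0_ler_powR; rewrite ?nnegrE ?(ltW p0)// (le_trans x0).
have [g sg gp] := smooth_powR b p a0.
exists a, b, g; split; rewrite ?a0//.
rewrite !gp ?lexx ?ab//; split.
  by rewrite [leRHS]root//; apply: mono; [exact: ltW|rewrite ge_min lexx orbT].
by rewrite [leLHS]root//; apply: mono; [exact: powR_ge0|rewrite le_max lexx orbT].
Qed.

End inside_Omega.

Section wellposed.
Context {R : realType}.
Local Notation plane := (measurableTypeR R * measurableTypeR R)%type.
Variables (sigma p : R).
Hypotheses (sigma0 : 0 < sigma) (p0 : 0 < p).
Variable mu0 : @planar_probability R.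

Lemma solution_exists (r M : R) : 0 < r -> r <= M -> mu0 (~` box r M r M) = 0%E ->
  exists2 mu, global_solution sigma p mu0 mu & uniformly_inside_Omega mu.
Proof.
move=> r0 rM mu0B.
have [a [b [g [/andP[a0 ar] Mb sg gp [ga gb]]]]] := inward_box p0 r0 rM.
have ab : a <= b := le_trans ar (le_trans rM Mb).
have {}mu0B : mu0 (~` box a b r M) = 0%E.
  apply: (@subset_measure0 _ _ _ mu0 (~` box a b r M : set plane) (~` box r M r M : set plane)) => //.
  - by apply: measurableC; exact: measurable_box.
  - by apply: measurableC; exact: measurable_box.
  - by apply: subsetC; exact: box_sub.
have [Y [N [L [N0 _ Y0 gY [_ Yd]]]]] := characteristics sigma0 a0 ab rM sg ga gb mu0B.
exists (evolution r M mu0 gY).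
  exact: (evolution_solution a0 r0 rM sg gp mu0B N0 Y0 gY (fun s t x s0 st => proj1 (Yd s t x s0 st))
    (fun s t x s0 st => proj2 (Yd s t x s0 st))).
by apply: (box_inside (b := b) (d := M) a0 r0) => t _; exact: evolution_box.
Qed.

Lemma solution_unique (mu nu : R -> @planar_probability R) :
  global_solution sigma p mu0 mu -> uniformly_inside_Omega mu ->
  global_solution sigma p mu0 nu -> uniformly_inside_Omega nu ->
  forall t, 0 <= t -> same_measure (nu t) (mu t).
Proof.
move=> smu /inside_box[r1 [M1 [r10 mu1]]] snu /inside_box[r2 [M2 [r20 nu2]]] t t0.
(* Both solutions must live in one invariant box, with the same g, before they can be compared. *)
pose r := Num.min r1 r2; pose M := Num.max (Num.max M1 M2) r.
have r0 : 0 < r by rewrite lt_min r10.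
have rM : r <= M by rewrite le_max lexx orbT.
have [a [b [g [/andP[a0 ar] Mb sg gp [ga gb]]]]] := inward_box p0 r0 rM.
have ab : a <= b := le_trans ar (le_trans rM Mb).
have mB := @measurable_box R a b r M.
have rr1 : r <= r1 by rewrite ge_min lexx.
have rr2 : r <= r2 by rewrite ge_min lexx orbT.
have MM1 : M1 <= M by rewrite !le_max lexx.
have MM2 : M2 <= M by rewrite !le_max lexx orbT.
have muB s : 0 <= s -> mu s (~` box a b r M) = 0%E.
  move=> s0; apply: supp_null mB; apply: subset_trans (mu1 s s0) _.
  by apply: box_sub => //; [exact: le_trans rr1|exact: le_trans Mb].
have nuB s : 0 <= s -> nu s (~` box a b r M) = 0%E.
  move=> s0; apply: supp_null mB; apply: subset_trans (nu2 s s0) _.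
  by apply: box_sub => //; [exact: le_trans rr2|exact: le_trans Mb].
have H1 := solution_solves a0 r0 sg gp smu muB.
have H2 := solution_solves a0 r0 sg gp snu nuB.
have init psi : alg psi -> \int[nu 0]_(x in Omega) psi x = \int[mu 0]_(x in Omega) psi x.
  move=> _; rewrite /Rintegral; congr fine; apply: eq_measure_integral => A mA _.
  have [_ _ E1 _] := smu 1 ltr01; have [_ _ E2 _] := snu 1 ltr01.
  by rewrite [LHS]E2// [RHS]E1.
have E := solves_unique sigma0 a0 r0 ab sg ga gb H2 H1 init t0.
apply: (alg_separates mB (nuB t t0) (muB t t0) (box_Omega a0 r0)) => psi ap; last exact: E.
by apply: tame_continuous; exact: alg_continuous.
Qed.

End wellposed.

Theorem theorem2p3 (R : realType) (sigma p : R) (hsigma : 0 < sigma) (hp : 0 < p)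
    (mu0 : @planar_probability R) (hmu0 : in_P0 mu0)
    (ymin ymax thetamin thetamax : R)
    (hymin : 0 < ymin) (hthetamin : 0 < thetamin)
    (hsupp : supp mu0 `<=`
       `[ymin, ymax]%classic `*` `[thetamin, thetamax]%classic) :
  exists mu : R -> @planar_probability R,
    (global_solution sigma p mu0 mu /\ uniformly_inside_Omega mu) /\
    forall nu : R -> @planar_probability R,
      global_solution sigma p mu0 nu -> uniformly_inside_Omega nu ->
      forall t : R, 0 <= t -> same_measure (nu t) (mu t).
Proof.
pose r := Num.min ymin thetamin; pose M := Num.max (Num.max ymax thetamax) r.
have r0 : 0 < r by rewrite lt_min hymin.
have rM : r <= M by rewrite le_max lexx orbT.
have mu0B : mu0 (~` box r M r M) = 0%E.
  apply: supp_null; last exact: measurable_box.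
  apply: subset_trans hsupp _; apply: box_sub; rewrite ?ge_min ?le_max ?lexx ?orbT//.
have [mu smu imu] := solution_exists hsigma hp r0 rM mu0B.
exists mu; split=> // nu snu inu; exact: solution_unique smu imu snu inu.
Qed.
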